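(* Let $L\subseteq S_2^*$ be a linear subspace that meets the interior of $S_+$, and let $K=S_+\cap L\subsetneq S_+$. Suppose every extreme ray of $K$ has rank $1$. Then there is a non-degenerate, reduced, $2$-regular, totally real scheme $X\subseteq\mathbb{P}^n$ such that $K=\Sigma_X^*$ is the Hankel spectrahedron of $X$ and $L=(I(X)_2)^\perp$.
   Context: $S=\mathbb{R}[x_0,\dots,x_n]$, $S_d$ its degree-$d$ part. For $\ell\in S_2^*$, $B_\ell(f,g)=\ell(fg)$ is a symmetric bilinear form on $S_1$; the rank of $\ell$ is the rank of $B_\ell$, and $S_+$ is the cone of $\ell$ with $B_\ell$ positive semidefinite. The rank of an extreme ray is the rank of a nonzero element spanning it. For a reduced scheme $X$ with vanishing ideal $I(X)$, $(I(X)_2)^\perp=\{\ell\in S_2^*:\ell(I(X)_2)=0\}$ and the Hankel spectrahedron is $\Sigma_X^*=S_+\cap(I(X)_2)^\perp$ (the dual of the cone of sums of squares of linear forms in $S/I(X)$). $X$ is totally real if $X(\mathbb{R})$ is Zariski dense in $X$; non-degenerate if not in a hyperplane; $2$-regular if $I(X)$ has Castelnuovo–Mumford regularity $2$. *)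

(* Defs.v *)
From HB Require Import structures.
From mathcomp Require Import all_boot all_order all_algebra.
From mathcomp Require Import reals.
From mathcomp Require Import mpoly.
Set Implicit Arguments. Unset Strict Implicit. Unset Printing Implicit Defensive.
Import Order.TTheory GRing.Theory Num.Theory.
Local Open Scope ring_scope.

Section Defs.
Variables (R : realType) (n : nat).

Definition Spoly := {mpoly R[n.+1]}.

(* An element of S_2^* is represented by its extension by zero to S:
   a linear functional on S that only depends on the degree-2 component. *)
Definition S2dual (l : Spoly -> R) : Prop :=
  (forall (a : R) (p q : Spoly), l (a *: p + q) = a * l p + l q) /\
  (forall p : Spoly, l p = l (pihomog mdeg 2 p)).

Definition is_subspace (L : (Spoly -> R) -> Prop) : Prop :=
  (forall l, L l -> S2dual l) /\ L (fun _ => 0) /\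
  (forall (a : R) l1 l2, L l1 -> L l2 -> L (fun p => a * l1 p + l2 p)).

Definition psd (l : Spoly -> R) : Prop :=
  forall f : Spoly, f \is 1.-homog -> 0 <= l (f * f).

Definition Splus (l : Spoly -> R) : Prop := S2dual l /\ psd l.

Definition Bmat (l : Spoly -> R) : 'M[R]_n.+1 :=
  \matrix_(i, j) l ('X_i * 'X_j).
Definition rank_of (l : Spoly -> R) : nat := \rank (Bmat l).

(* l lies in the interior of S_+ (topology of the finite-dim space S_2^*,
   using the sup-norm of the coordinates l(x_i x_j)) *)
Definition in_interior_Splus (l : Spoly -> R) : Prop :=
  S2dual l /\ exists eps : R, 0 < eps /\
    forall l', S2dual l' ->
      (forall i j : 'I_n.+1, `|l' ('X_i * 'X_j) - l ('X_i * 'X_j)| < eps) ->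
      Splus l'.

Definition spans_extreme_ray (K : (Spoly -> R) -> Prop) (l : Spoly -> R) : Prop :=
  K l /\ (exists p, l p != 0) /\
  forall a b, K a -> K b -> (forall p, l p = a p + b p) ->
    (exists c : R, 0 <= c /\ forall p, a p = c * l p) /\
    (exists c : R, 0 <= c /\ forall p, b p = c * l p).

(* A reduced totally real scheme X in P^n is the Zariski closure of its set
   of real points; we encode X by a set Z of (nonzero representatives of)
   real points.  I(X)_d = homogeneous forms of degree d vanishing on Z. *)
Definition Ipart (Z : ('I_n.+1 -> R) -> Prop) (d : nat) (f : Spoly) : Prop :=
  f \is d.-homog /\ forall v, Z v -> f.@[v] = 0.

Definition X_nondegenerate (Z : ('I_n.+1 -> R) -> Prop) : Prop :=
  forall h : Spoly, h \is 1.-homog -> (forall v, Z v -> h.@[v] = 0) -> h = 0.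

Definition I2perp (Z : ('I_n.+1 -> R) -> Prop) (l : Spoly -> R) : Prop :=
  S2dual l /\ forall f, Ipart Z 2 f -> l f = 0.
Definition Hankel (Z : ('I_n.+1 -> R) -> Prop) (l : Spoly -> R) : Prop :=
  Splus l /\ I2perp Z l.

(* Koszul complex K(x_0..x_n) (x) I(X): an element of wedge^i S_1 (x) I_d is a
   family c indexed by subsets of {0..n} with c S in I_d for #|S| = i and
   c S = 0 otherwise.  Differential:
   d(e_S (x) p) = sum_{k in S} (-1)^{#{m in S | m < k}} e_{S\k} (x) x_k p. *)
Definition kdiff (c : {set 'I_n.+1} -> Spoly) (T : {set 'I_n.+1}) : Spoly :=
  \sum_(k | k \notin T) (-1) ^+ #|[set m in T | (val m < val k)%N]| * ('X_k * c (k |: T)).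

Definition chain (Z : ('I_n.+1 -> R) -> Prop) (i d : nat)
    (c : {set 'I_n.+1} -> Spoly) : Prop :=
  forall S : {set 'I_n.+1}, (#|S| = i -> Ipart Z d (c S)) /\ (#|S| <> i -> c S = 0).

(* chains in wedge^i S_1 (x) I_(d-1), with I_(-1) = 0 *)
Definition chain_pred (Z : ('I_n.+1 -> R) -> Prop) (i d : nat)
    (b : {set 'I_n.+1} -> Spoly) : Prop :=
  match d with
  | 0 => forall S : {set 'I_n.+1}, b S = 0
  | d'.+1 => chain Z i d' b
  end.

(* Tor_i^S(I(X), R)_(i+d) = 0, computed as Koszul homology *)
Definition tor_vanishes (Z : ('I_n.+1 -> R) -> Prop) (i d : nat) : Prop :=
  forall c, chain Z i d c -> (forall T : {set 'I_n.+1}, (#|T|.+1 = i)%N -> kdiff c T = 0) ->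
    exists b, chain_pred Z i.+1 d b /\
      forall S : {set 'I_n.+1}, #|S| = i -> c S = kdiff b S.

(* reg I(X) <= m  iff  Tor_i(I(X), R)_j = 0 for all j > i + m *)
Definition reg_le (Z : ('I_n.+1 -> R) -> Prop) (m : nat) : Prop :=
  forall i d : nat, (m < d)%N -> tor_vanishes Z i d.

Definition two_regular (Z : ('I_n.+1 -> R) -> Prop) : Prop :=
  reg_le Z 2 /\ ~ reg_le Z 1.

End Defs.

(* Main.v *)
(** Let [Z] be the set of vectors whose point evaluation lies in [L]. Extreme rays of
  rank 1 and Krein-Milman show that [K] is spanned by these evaluations, so [L] is the
  annihilator of the quadrics vanishing on [Z].

  For 2-regularity, project [Z] successively from its own points; the cones over the
  projections are the sets [W = Z + span(z_1, ..., z_k)], and one descends from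
  [W + R z] to [W]. Given [z] in [W], put [T = {D_z Q : Q a quadric vanishing on W}].
  Dividing [f(w + c z)] by [c] identifies [I(W) / I(W + R z)] with
  [(T) / I(W + R z)], lowering degrees by one, and a chase in the Koszul complex yields
  the regularity of [I(W)]. The quotient does lie in [(T)] provided the leading
  coefficient at [z] of every [f] in [I(W)] vanishes on the zero set of [T]. This holds
  for [z] with [dim T] maximal: the hypothesis
  on [K] implies that at each point of [W] the quadrics of [I(W)] already span all
  differentials of [I(W)] (otherwise a first order deformation of a sum of point
  evaluations leaves the cone generated by point evaluations), so the vector fields
  annihilating a maximal independent set of quadrics preserve [I(W)], and they fill
  the zero set of [T] at [z]. *)

Require Import Defs.
From HB Require Import structures.
From mathcomp Require Import all_boot all_order all_algebra.
From mathcomp Require Import boolp reals ring lra.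
From mathcomp Require Import mpoly.
Set Implicit Arguments. Unset Strict Implicit. Unset Printing Implicit Defensive.
Import Order.TTheory GRing.Theory Num.Theory.
Local Open Scope ring_scope.

(** * Directional derivatives of polynomials *)

Section PolynomialCalculus.
Variables (R : realType) (N : nat).
Implicit Types (f g p q : {mpoly R[N]}) (x y v w z : 'I_N -> R).

(** The bound 2 survives each descent because [(T)] is the ideal of a linear space, hence 1-regular,
    and enters with its degrees shifted by one. The rank is maximised over all of [W], since the
    determinantal vector fields preserve [I(W)] only if the bound holds at every point of [W]. The
    maximising [z] need not be a projected point, but the cylinder depends only on [z] modulo the
    span, so the descent still runs through cones over points of [Z]; it stops when the span is the
    whole space and the ideal is zero. The scheme is known only through real points, so equality of
    polynomials is tested by evaluation, and generators are produced only for ideals of linear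
    spaces. Degree in the direction [z] is measured by iterating [D_z], which avoids a change of
    coordinates. That [I(X)] is not 1-regular comes from the strict inclusion of [K] in [S_+], which
    provides a quadric, while non-degeneracy excludes linear forms. *)

Lemma mpoly_alg_ind (P : {mpoly R[N]} -> Prop) :
  (forall c, P c%:MP) -> (forall i, P 'X_i) ->
  (forall p q, P p -> P q -> P (p + q)) ->
  (forall p q, P p -> P q -> P (p * q)) -> forall p, P p.
Proof.
move=> PC PX PD PM; elim/mpolyind => [|c m p _ _ Pp]; first by rewrite -mpolyC0.
apply: (PD) => //; rewrite -mul_mpolyC; apply: (PM); first exact: PC.
rewrite mpolyXE_id; elim/big_rec: _ => [|i q _ Pq]; first by rewrite -mpolyC1.
apply: (PM) => //; elim: (m i) => [|k IH]; first by rewrite expr0 -mpolyC1.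
by rewrite exprS; apply: (PM).
Qed.

(** The integers from 1 to [size p] are distinct nonzero roots, one more than the degree allows. The
    parameter 0 is left out because cones are stable under nonzero scalars only. *)
Lemma poly_eq0_off0 (p : {poly R}) : (forall t, t != 0 -> p.[t] = 0) -> p = 0.
Proof.
move=> p0; apply: (@roots_geq_poly_eq0 _ p [seq i%:R | i <- iota 1 (size p)]).
- apply/allP => _ /mapP[i + ->]; rewrite mem_iota => /andP[i1 _].
  by apply/rootP/p0; rewrite pnatr_eq0 -lt0n.
- by rewrite map_inj_uniq ?iota_uniq //; apply: mulrIn; rewrite oner_eq0.
- by rewrite size_map size_iota.
Qed.

Definition dirder v f : {mpoly R[N]} := \sum_i v i *: f^`M(i).

Lemma dirderD v : {morph dirder v : p q / p + q}.
Proof.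
move=> p q; rewrite /dirder -big_split; apply: eq_bigr => i _.
by rewrite mderivD scalerDr.
Qed.

Lemma dirderC v c : dirder v c%:MP = 0.
Proof. by rewrite /dirder big1 // => i _; rewrite mderivC scaler0. Qed.

Lemma dirderM v p q : dirder v (p * q) = dirder v p * q + p * dirder v q.
Proof.
rewrite /dirder mulr_suml mulr_sumr -big_split; apply: eq_bigr => i _ /=.
by rewrite mderivM scalerDr scalerAl scalerAr.
Qed.

Lemma dirderZ v c p : dirder v (c *: p) = c *: dirder v p.
Proof. by rewrite -!mul_mpolyC dirderM dirderC mul0r add0r. Qed.

Lemma dirder0 v : dirder v 0 = 0.
Proof. by rewrite -mpolyC0 dirderC. Qed.

Lemma dirderN v p : dirder v (- p) = - dirder v p.
Proof. by rewrite -scaleN1r dirderZ scaleN1r. Qed.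

Lemma dirderB v p q : dirder v (p - q) = dirder v p - dirder v q.
Proof. by rewrite dirderD dirderN. Qed.

Lemma dirder_sum v I (r : seq I) (P : pred I) (F : I -> {mpoly R[N]}) :
  dirder v (\sum_(i <- r | P i) F i) = \sum_(i <- r | P i) dirder v (F i).
Proof. exact: (big_morph _ (dirderD v) (dirder0 v)). Qed.

Lemma mderivXU i j : ('X_j : {mpoly R[N]})^`M(i) = (i == j)%:R%:MP.
Proof.
rewrite mderivX mnm1E eq_sym; case: eqP => [->|_]; last by rewrite scale0r mpolyC0.
have -> : (U_(j) - U_(j) = 0 :> 'X_{1..N})%MM by apply/mnmP => k; rewrite mnmBE subnn mnm0E.
  by rewrite scale1r mpolyX0 mpolyC1.
Qed.

Lemma dirderX v i : dirder v 'X_i = (v i)%:MP.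
Proof.
rewrite /dirder (bigD1 i) //= mderivXU eqxx big1 ?addr0 => [|j /negPf ji].
  by rewrite -mul_mpolyC -mpolyCM mulr1.
by rewrite mderivXU ji mpolyC0 scaler0.
Qed.

Lemma mderiv_dirder i v p : (dirder v p)^`M(i) = dirder v (p^`M(i)).
Proof.
rewrite /dirder raddf_sum; apply: eq_bigr => j _ /=.
by rewrite mderivZ mderiv_comm.
Qed.

Lemma dirder_comm v w p : dirder v (dirder w p) = dirder w (dirder v p).
Proof.
rewrite [in RHS]/dirder dirder_sum; apply: eq_bigr => i _ /=.
by rewrite dirderZ mderiv_dirder.
Qed.

Lemma dirder_lin (a b : R) v w p u : (forall i, u i = a * v i + b * w i) ->
  dirder u p = a *: dirder v p + b *: dirder w p.
Proof.
move=> uE; rewrite /dirder !scaler_sumr -big_split; apply: eq_bigr => i _ /=.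
by rewrite uE scalerDl !scalerA.
Qed.

Lemma dirder_delta i p : dirder (fun j => (j == i)%:R) p = p^`M(i).
Proof.
rewrite /dirder (bigD1 i) //= eqxx scale1r big1 ?addr0 // => j /negPf ->.
by rewrite scale0r.
Qed.

(** The restriction of [f] to an affine line as a univariate polynomial; homogeneous components,
    Euler's identity and first-order arguments are read off from it. *)
Definition line f x v : {poly R} :=
  mmap (@polyC R) (fun i => (x i)%:P + v i *: 'X) f.

Lemma lineD f g x v : line (f + g) x v = line f x v + line g x v.
Proof. by rewrite /line mmapD. Qed.

Lemma lineM f g x v : line (f * g) x v = line f x v * line g x v.
Proof. by rewrite /line (mmap_is_multiplicative _ _).1. Qed.

Lemma lineC c x v : line c%:MP x v = c%:P.
Proof. by rewrite /line mmapC. Qed.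

Lemma lineX i x v : line 'X_i x v = (x i)%:P + v i *: 'X.
Proof. by rewrite /line mmapX mmap1U. Qed.

Lemma horner_line f x v t : (line f x v).[t] = f.@[fun i => x i + t * v i].
Proof.
elim/mpoly_alg_ind: f => [c|i|p q Hp Hq|p q Hp Hq].
- by rewrite lineC hornerC mevalC.
- by rewrite lineX mevalXU !hornerE mulrC.
- by rewrite lineD hornerD Hp Hq mevalD.
- by rewrite lineM hornerM Hp Hq mevalM.
Qed.

Lemma deriv_line f x v : (line f x v)^`() = line (dirder v f) x v.
Proof.
elim/mpoly_alg_ind: f => [c|i|p q Hp Hq|p q Hp Hq].
- by rewrite lineC derivC dirderC -mpolyC0 lineC.
- by rewrite lineX dirderX lineC derivD derivC add0r derivZ derivX alg_polyC.
- by rewrite lineD derivD Hp Hq dirderD lineD.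
- by rewrite lineM derivM Hp Hq dirderM lineD !lineM.
Qed.

(** The restriction to the line is the zero polynomial, so its value and derivative at 0 vanish.
    Tangency arguments enter the algebra through this statement. *)
Lemma dirder_eval0 f x v :
  (forall t, t != 0 -> f.@[fun i => x i + t * v i] = 0) ->
  f.@[x] = 0 /\ (dirder v f).@[x] = 0.
Proof.
move=> f0; have l0 : line f x v = 0.
  by apply: poly_eq0_off0 => t t0; rewrite horner_line f0.
have ev g : (line g x v).[0] = g.@[x].
  by rewrite horner_line; apply: meval_eq => i; rewrite mul0r addr0.
by split; rewrite -ev -?deriv_line l0 ?deriv0 horner0.
Qed.

Lemma mnm_neq0 (m : 'X_{1..N}) : m != 0%MM -> exists i, m i != 0%N.
Proof.
move=> m0; apply/existsP; apply: contraNT m0 => /existsPn m0.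
by apply/eqP/mnmP => i; rewrite mnm0E; apply/eqP/negbNE/m0.
Qed.

Lemma meval_at0 f : f.@[fun=> 0] = f@_0.
Proof.
elim/mpolyind: f => [|c m p _ _ IH]; first by rewrite meval0 mcoeff0.
rewrite mevalD mcoeffD IH mevalZ mcoeffZ mevalX mcoeffX; congr (_ * _ + _).
have [->|m0] := eqVneq; first by rewrite big1 // => i _; rewrite mnm0E expr0.
have [i mi] := mnm_neq0 m0.
by rewrite (bigD1 i) //= expr0n (negPf mi) mul0r.
Qed.

(** Induction on the degree of a monomial: for [i] in its support the coefficient is, up to a
    nonzero integer factor, a coefficient of the partial derivative along [i], which again vanishes
    everywhere. *)
Lemma mpoly_ext f g : (forall x, f.@[x] = g.@[x]) -> f = g.
Proof.
move=> fg; apply/eqP; rewrite -subr_eq0; apply/eqP/mpolyP => m.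
have {fg}: forall x, (f - g).@[x] = 0 by move=> x; rewrite mevalB fg subrr.
move: (f - g) => {f g}; have [d] := ubnP (mdeg m).
elim: d m => // d IH m; rewrite ltnS => md f f0; rewrite mcoeff0.
have [->|m0] := eqVneq m 0%MM; first by rewrite -meval_at0 f0.
have [i mi] := mnm_neq0 m0.
have mE : (m = (m - U_(i)) + U_(i))%MM.
  by rewrite submK // lep1mP.
have md' : (mdeg (m - U_(i)) < d)%N.
  by move: md; rewrite {1}mE mdegD mdeg1 addn1.
have := IH _ md' (f^`M(i)) _; rewrite mcoeff_deriv -mE mcoeff0.
move=> /(_ _)/eqP; rewrite -mulr_natr mulf_eq0 pnatr_eq0 orbF => H.
apply/eqP/H => x; rewrite -dirder_delta.
by have [] := @dirder_eval0 f x (fun j => (j == i)%:R) (fun t _ => f0 _).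
Qed.

Lemma line0X m x :
  line 'X_[m] (fun=> 0) x = ('X_[m] : {mpoly R[N]}).@[x] *: 'X^(mdeg m).
Proof.
rewrite mevalX mdegE /line mmapX /mmap1.
rewrite (big_morph (fun k => 'X^k : {poly R}) (exprD 'X) (expr0 'X)).
rewrite -scaler_prod; apply: eq_bigr => i _.
by rewrite add0r exprZn.
Qed.

Lemma coef_line0 f x d :
  (line f (fun=> 0) x)`_d = (pihomog mdeg d f).@[x].
Proof.
elim/mpolyind: f => [|c m p _ _ IH].
  by rewrite -mpolyC0 lineC pihomog0 meval0 coefC if_same.
rewrite lineD coefD IH pihomogD mevalD; congr (_ + _).
rewrite -mul_mpolyC lineM lineC line0X coefCM coefZ coefXn mul_mpolyC.
rewrite linearZ /= mevalZ pihomogX eq_sym; case: eqP => _; first by rewrite mulr1.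
by rewrite meval0 mulr0.
Qed.

Lemma line_homog d f x : f \is d.-homog ->
  line f (fun=> 0) x = f.@[x] *: 'X^d.
Proof.
move=> hf; apply/polyP => e; rewrite coef_line0 coefZ coefXn.
have [->|ed] := eqVneq; first by rewrite pihomog_dE // mulr1.
by rewrite (pihomog_ne0 _ hf) ?meval0 ?mulr0 // eq_sym.
Qed.

Lemma homog_scale d f x t : f \is d.-homog ->
  f.@[fun i => t * x i] = t ^+ d * f.@[x].
Proof.
move=> hf; have /(congr1 (horner^~ t)) := line_homog x hf.
rewrite horner_line hornerZ hornerXn mulrC => <-.
by apply: meval_eq => i; rewrite add0r.
Qed.

Lemma homog_mderiv d i f : f \is d.+1.-homog -> f^`M(i) \is d.-homog.
Proof.
move=> hf; apply/dhomogP => m; rewrite mcoeff_msupp mcoeff_deriv => H.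
have : (m + U_(i))%MM \in msupp f.
  by rewrite mcoeff_msupp; apply: contra_neq H => ->; rewrite mul0rn.
by move/(dhomog_mf hf) => /=; rewrite mdegD mdeg1 addn1 => -[].
Qed.

Lemma homog_dirder d v f : f \is d.+1.-homog -> dirder v f \is d.-homog.
Proof.
by move=> hf; apply: rpred_sum => i _; apply: rpredZ; apply: homog_mderiv.
Qed.

Lemma euler_eval d f x : f \is d.-homog -> (dirder x f).@[x] = d%:R * f.@[x].
Proof.
move=> hf; have /(congr1 (fun q : {poly R} => q^`().[1])) := line_homog x hf.
rewrite deriv_line horner_line derivZ derivXn hornerZ hornerMn hornerXn expr1n.
by rewrite mulrC => <-; apply: meval_eq => i; rewrite add0r mul1r.
Qed.

Lemma meval_dirder v f x : (dirder v f).@[x] = \sum_i v i * (f^`M(i)).@[x].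
Proof. by rewrite raddf_sum; apply: eq_bigr => i _ /=; rewrite mevalZ. Qed.

Lemma euler d f : f \is d.-homog -> \sum_i 'X_i * f^`M(i) = d%:R *: f.
Proof.
move=> hf; apply: mpoly_ext => x; rewrite mevalZ -(euler_eval x hf) meval_dirder.
by rewrite raddf_sum; apply: eq_bigr => i _ /=; rewrite mevalM mevalXU.
Qed.

End PolynomialCalculus.

(** * The Koszul complex *)

Section Koszul.
Variables (R : realType) (n : nat).
Local Notation S := (Spoly R n).
Local Notation cochain := ({set 'I_n.+1} -> S).
Implicit Types (c b : cochain) (A T : {set 'I_n.+1}) (k l : 'I_n.+1).

Definition ksign k T : S := (-1) ^+ #|[set m in T | (val m < val k)%N]|.

Lemma ksignU k l T : k \notin T ->
  ksign l (k |: T) = (-1) ^+ (val k < val l)%N * ksign l T.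
Proof.
move=> kT; rewrite /ksign -exprD; congr (_ ^+ _).
have -> : [set m in k |: T | (val m < val l)%N] =
    (if (val k < val l)%N then [set k] else set0) :|: [set m in T | (val m < val l)%N].
  by apply/setP => m; rewrite !inE andb_orl; congr (_ || _);
    case: eqP => [->|mk]; case: ifP => //; rewrite !inE // ?eqxx //; move/eqP/negPf: mk.
rewrite cardsU; case: ifP => _.
  rewrite cards1 [X in (_ - X)%N](_ : _ = 0%N) ?subn0 //.
  by apply/eqP; rewrite cards_eq0 -subset0; apply/subsetP => m;
     rewrite !inE => /andP[/eqP -> /andP[]]; rewrite (negPf kT).
by rewrite cards0 set0I cards0 subn0.
Qed.

Lemma ksign_sq k T : ksign k T * ksign k T = 1.
Proof. by rewrite -exprD addnn -muln2 exprM sqrr_sign. Qed.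

Lemma ksignD1 k T : k \in T -> ksign k (T :\ k) = ksign k T.
Proof. by move=> kT; rewrite -[in RHS](setD1K kT) ksignU ?setD11 // ltnn mul1r. Qed.

Lemma ksign_swap k l T : k != l -> k \notin T -> l \notin T ->
  ksign k T * ksign l (k |: T) = - (ksign l T * ksign k (l |: T)).
Proof.
move=> kl kT lT; rewrite !ksignU // (mulrCA (ksign k T)) (mulrCA (ksign l T)) (mulrC (ksign l T)).
have -> : ((val l < val k)%N = ~~ (val k < val l)%N).
  by rewrite -leqNgt ltn_neqAle (inj_eq val_inj) eq_sym kl.
by case: (val k < val l)%N; rewrite /= ?expr0 ?expr1 ?mul1r ?mulN1r ?opprK.
Qed.

Lemma kdiffE c T : kdiff c T = \sum_(k | k \notin T) ksign k T * ('X_k * c (k |: T)).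
Proof. by []. Qed.

Lemma kdiff_ext c b T : (forall k, k \notin T -> c (k |: T) = b (k |: T)) ->
  kdiff c T = kdiff b T.
Proof. by move=> E; apply: eq_bigr => k kT; rewrite E. Qed.

Lemma kdiffD c b T : kdiff (fun A => c A + b A) T = kdiff c T + kdiff b T.
Proof. by rewrite !kdiffE -big_split; apply: eq_bigr => k _; rewrite !mulrDr. Qed.

Lemma kdiffB c b T : kdiff (fun A => c A - b A) T = kdiff c T - kdiff b T.
Proof. by rewrite !kdiffE -sumrB; apply: eq_bigr => k _; rewrite !mulrBr. Qed.

Lemma kdiff0 T : kdiff (fun=> 0) T = 0 :> S.
Proof. by rewrite kdiffE big1 // => k _; rewrite !mulr0. Qed.

Lemma kdiff_kdiff c T : kdiff (kdiff c) T = 0.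
Proof.
pose F k l := ksign k T * ksign l (k |: T) * ('X_k * 'X_l * c (k |: (l |: T))).
have E : kdiff (kdiff c) T =
    \sum_(k | k \notin T) \sum_(l | (l \notin T) && (k != l)) F k l.
  rewrite kdiffE; apply: eq_bigr => k kT; rewrite kdiffE !mulr_sumr.
  apply: eq_big => l; first by rewrite !inE negb_or andbC eq_sym.
  by move=> _; rewrite /F setUCA; ring.
(* Exchanging the two indices turns the double sum into its negative, and 2 is invertible. *)
have : kdiff (kdiff c) T = - kdiff (kdiff c) T.
  rewrite {1}E (exchange_big_dep (fun l => l \notin T)) /=; last by move=> k l _ /andP[].
  rewrite E -sumrN; apply: eq_bigr => l lT; rewrite -sumrN.
  apply: eq_big => k; first by rewrite lT eq_sym.
  move=> /and3P[kT _ kl]; rewrite /F ksign_swap // mulNr setUCA.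
  by congr (- (_ * (_ * _))); rewrite mulrC.
move/eqP; rewrite -addr_eq0 -mulr2n -scaler_nat scaler_eq0 pnatr_eq0 /=.
by move/eqP.
Qed.

(** With [e_A] read as the differential form [dx_A], this is the exterior derivative. *)
Definition derham c : cochain :=
  fun A => \sum_(k in A) ksign k A * (c (A :\ k))^`M(k).

Lemma mderiv_ksign k T i (p : S) : (ksign k T * p)^`M(i) = ksign k T * p^`M(i).
Proof.
have -> : ksign k T = ((-1) ^+ #|[set m in T | (val m < val k)%N]|)%:MP.
  by rewrite rmorphXn /= mpolyCN mpolyC1.
by rewrite mderiv_mulC.
Qed.

(* Cartan's formula for the Euler vector field: [kdiff] is contraction with it. *)
Lemma kdiff_derham c A :
  kdiff (derham c) A + derham (kdiff c) A =
  \sum_k 'X_k * (c A)^`M(k) + #|A|%:R *: c A.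
Proof.
(* The terms that add [k] and remove an [l] of [A]: they occur in both composites with opposite
   signs, and only the terms with [k = l] survive. *)
pose G k l := ksign k A * ksign l (k |: A) * ('X_k * (c ((k |: A) :\ l))^`M(l)).
have -> : kdiff (derham c) A = \sum_(k | k \notin A) 'X_k * (c A)^`M(k) +
    \sum_(k | k \notin A) \sum_(l in A) G k l.
  rewrite kdiffE -big_split; apply: eq_bigr => k kA; rewrite /derham.
  rewrite big_setU1 //= !mulrDr; congr (_ + _); last first.
    by rewrite !mulr_sumr; apply: eq_bigr => l _; rewrite /G; ring.
  rewrite setU1K // ksignU // ltnn mul1r -[RHS]mul1r -(ksign_sq k A); ring.
have -> : derham (kdiff c) A = \sum_(k in A) (c A + 'X_k * (c A)^`M(k)) +
    \sum_(l in A) \sum_(k | k \notin A) - G k l.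
  rewrite /derham -big_split; apply: eq_bigr => l lA /=.
  rewrite kdiffE (bigD1 l) ?setD11 //= mderivD mulrDr; congr (_ + _).
    rewrite mderiv_ksign mulrA ksignD1 // ksign_sq mul1r setD1K // mderivM mderivXU eqxx.
    by rewrite mpolyC1 mul1r.
  rewrite raddf_sum mulr_sumr /=; apply: eq_big => k.
    by rewrite !inE negb_and negbK; case: eqP => [->|]; rewrite ?lA // andbT.
  rewrite !inE negb_and negbK => /andP[+ kl]; rewrite (negPf kl) /= => kA.
  have lAl : l \notin A :\ l by rewrite setD11.
  have kAl : k \notin A :\ l by rewrite !inE negb_and kA orbT.
  rewrite mderiv_ksign mderivM mderivXU eq_sym (negPf kl) mul0r add0r /G.
  have -> : (k |: A) :\ l = k |: (A :\ l).
    by apply/setP => m; rewrite !inE; case: (m =P k) => [->|]; rewrite ?andbT // kl.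
  have -> : ksign k A * ksign l (k |: A) = - (ksign l A * ksign k (A :\ l)).
    rewrite -{1 2}(setD1K lA) setUCA [X in _ * X]ksignU; last first.
      by rewrite !inE eq_sym (negPf kl) eqxx.
    rewrite -(ksignD1 lA) ltnn mul1r; have := @ksign_swap k l _ kl kAl lAl.
    rewrite !(ksignU _ kAl) !(ksignU _ lAl).
    have : (-1) ^+ (val l < val k)%N * (-1) ^+ (val k < val l)%N = -1 :> S.
      have -> : ((val l < val k)%N = ~~ (val k < val l)%N).
        by rewrite -leqNgt ltn_neqAle (inj_eq val_inj) eq_sym kl.
      by case: (val k < val l)%N; rewrite /= ?expr0 ?expr1 ?mul1r ?mulr1.
    by move=> E _; rewrite mulrACA E mulN1r mulrC.
  by rewrite mulNr opprK !mulrA.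
rewrite [X in _ + (_ + X)]exchange_big /= addrACA.
have -> : \sum_(k | k \notin A) \sum_(l in A) G k l +
    \sum_(k | k \notin A) \sum_(l in A) - G k l = 0.
  rewrite -big_split big1 // => k _; rewrite -big_split big1 // => l _ /=.
  by rewrite subrr.
rewrite addr0 big_split /= sumr_const addrCA addrC scaler_nat; congr (_ + _).
by rewrite [RHS](bigID (mem A)) /= addrC.
Qed.

(** The ideal of the empty set is all of [S]. On forms of degree [d.+1] in exterior degree [i],
    Cartan's formula and Euler's identity make [derham] divided by [d.+1 + i] a contracting
    homotopy. *)
Lemma tor_free m : reg_le (fun _ : 'I_n.+1 -> R => False) m.
Proof.
move=> i [//|d] _ c chc cyc; exists (fun A => (d.+1 + i)%:R^-1 *: derham c A).
have deg A : #|A| = i -> c A \is d.+1.-homog by move=> /(chc A).1[].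
split.
  move=> A; split=> [Ai|/eqP Ai]; last first.
    rewrite /derham big1 ?scaler0 // => k kA; rewrite (chc _).2 ?mderivwE ?mderiv0 ?mulr0 //.
    by move: Ai; rewrite (cardsD1 k) kA add1n eqSS => /eqP.
  split=> //; apply: rpredZ; apply: rpred_sum => k kA; rewrite /ksign -signr_odd.
  have : (c (A :\ k))^`M(k) \is d.-homog.
    apply/homog_mderiv/deg; move: Ai; rewrite (cardsD1 k) kA add1n.
    by case.
  by case: odd => h; rewrite ?expr1 ?expr0 ?mulN1r ?mul1r ?rpredN.
move=> A Ai; have := kdiff_derham c A.
rewrite (euler (deg _ Ai)) -scalerDl -natrD Ai.
have -> : derham (kdiff c) A = 0.
  rewrite /derham big1 // => k kA; rewrite cyc ?mderiv0 ?mulr0 //.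
  by rewrite -Ai [RHS](cardsD1 k) kA.
rewrite addr0 => E.
transitivity ((d.+1 + i)%:R^-1 *: kdiff (derham c) A).
  by rewrite E scalerA mulVf ?scale1r // pnatr_eq0.
rewrite !kdiffE scaler_sumr; apply: eq_bigr => k _.
by rewrite -!scalerAr.
Qed.

End Koszul.

(** * Vanishing ideals of cylinders *)

Section VanishingIdeals.
Variables (R : realType) (n : nat).
Local Notation S := (Spoly R n).
Local Notation vec := ('I_n.+1 -> R).
Implicit Types (W B : vec -> Prop) (u f g p q : S) (x v w z : vec) (A T : {set 'I_n.+1}).

Definition vanish W f := forall w, W w -> f.@[w] = 0.

Definition cone W := forall w t, t != 0 -> W w -> W (fun i => t * w i).

Definition shift x (c : R) z : vec := fun i => x i + c * z i.

Definition cyl W z : vec -> Prop := fun x => exists w c, W w /\ x = shift w c z.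

Lemma shift0 x z : shift x 0 z = x.
Proof. by apply: funext => i; rewrite /shift mul0r addr0. Qed.

Lemma shiftD x a b z : shift (shift x a z) b z = shift x (a + b) z.
Proof. by apply: funext => i; rewrite /shift mulrDl addrA. Qed.

Lemma sub_cyl W z w : W w -> cyl W z w.
Proof. by move=> Ww; exists w, 0; rewrite shift0. Qed.

Lemma vanishM W f p : vanish W f -> vanish W (p * f).
Proof. by move=> Wf w Ww; rewrite mevalM Wf // mulr0. Qed.

Lemma vanishD W f g : vanish W f -> vanish W g -> vanish W (f + g).
Proof. by move=> Wf Wg w Ww; rewrite mevalD Wf // Wg // addr0. Qed.

Lemma vanishB W f g : vanish W f -> vanish W g -> vanish W (f - g).
Proof. by move=> Wf Wg w Ww; rewrite mevalB Wf // Wg // subr0. Qed.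

Lemma vanishZ W (a : R) f : vanish W f -> vanish W (a *: f).
Proof. by move=> Wf w Ww; rewrite mevalZ Wf // mulr0. Qed.

Lemma line0E f x t : (line f (fun=> 0) x).[t] = f.@[fun i => t * x i].
Proof. by rewrite horner_line; apply: meval_eq => i; rewrite add0r. Qed.

Lemma vanish_homog W d f : cone W -> vanish W f -> vanish W (pihomog mdeg d f).
Proof.
move=> cW Wf w Ww; rewrite -coef_line0 (_ : line _ _ _ = 0) ?coef0 //.
by apply: poly_eq0_off0 => t t0; rewrite line0E; apply/Wf/cW.
Qed.

(* [f] is [c * u] at the point [w + c z] of the cylinder over [W]: this is the
   graph of an isomorphism [f |-> u] between subquotients of [S], which lowers
   degrees by one. *)
Definition slope W z u f :=
  forall w c, W w -> f.@[shift w c z] = c * u.@[shift w c z].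

Lemma slope_vanish W z u f : slope W z u f -> vanish W f.
Proof. by move=> h w Ww; rewrite -(shift0 w z) h // mul0r. Qed.

Lemma slopeD W z u f u' f' :
  slope W z u f -> slope W z u' f' -> slope W z (u + u') (f + f').
Proof. by move=> h h' w c Ww; rewrite !mevalD mulrDr h // h'. Qed.

Lemma slopeB W z u f u' f' :
  slope W z u f -> slope W z u' f' -> slope W z (u - u') (f - f').
Proof. by move=> h h' w c Ww; rewrite !mevalB mulrBr h // h'. Qed.

Lemma slopeM W z p u f : slope W z u f -> slope W z (p * u) (p * f).
Proof. by move=> h w c Ww; rewrite !mevalM mulrCA h. Qed.

Lemma slope0 W z : slope W z 0 0.
Proof. by move=> w c Ww; rewrite !meval0 mulr0. Qed.

Lemma slope_sum W z (I : Type) (r : seq I) (P : pred I) (u f : I -> S) :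
  (forall i, slope W z (u i) (f i)) ->
  slope W z (\sum_(i <- r | P i) u i) (\sum_(i <- r | P i) f i).
Proof.
move=> h; elim/big_rec2: _ => [|i a b _ hab]; first exact: slope0.
exact: slopeD.
Qed.

(** For nonzero [c] one may divide by [c]; the value at [c = 0] follows because [u] is polynomial
    along the line. *)
Lemma slope_cyl W z u f : slope W z u f ->
  vanish (cyl W z) u <-> vanish (cyl W z) f.
Proof.
move=> h; split=> van _ [w [c [Ww ->]]].
  by rewrite h // van ?mulr0 //; exists w, c.
have off c' : c' != 0 -> u.@[shift w c' z] = 0.
  move=> c0; have /eqP : f.@[shift w c' z] = 0 by apply: van; exists w, c'.
  by rewrite h // mulf_eq0 (negPf c0) => /eqP.
have [->|/off//] := eqVneq c 0.
by rewrite shift0; have [] := @dirder_eval0 _ _ u w z off.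
Qed.

(** On the line through the origin and [x = w + c z] the relation reads [f(t x) = t c u(t x)], so
    coefficients in [t] match with a shift by one. *)
Lemma slope_homog W z d u f : cone W -> slope W z u f ->
  slope W z (pihomog mdeg d u) (pihomog mdeg d.+1 f).
Proof.
move=> cW h w c Ww; set x := shift w c z.
have E : line f (fun=> 0) x = c%:P * 'X * line u (fun=> 0) x.
  apply/eqP; rewrite -subr_eq0; apply/eqP/poly_eq0_off0 => t t0.
  rewrite !hornerE !line0E (_ : (fun i => t * x i) = shift (fun i => t * w i) (t * c) z).
    rewrite h; last exact: cW.
    by ring.
  by apply: funext => i; rewrite /x /shift mulrDr mulrA.
by rewrite -!coef_line0 E -mulrA coefCM coefXM.
Qed.

Lemma slope_kdiff W z (u f : {set 'I_n.+1} -> S) T :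
  (forall A, slope W z (u A) (f A)) -> slope W z (kdiff u T) (kdiff f T).
Proof.
by move=> h; apply: slope_sum => k; do 2! apply: slopeM; apply: h.
Qed.

Lemma Ipart0 W d : Ipart W d (0 : S).
Proof. by split=> [|v _]; rewrite ?rpred0 ?meval0. Qed.

Lemma IpartD W d f g : Ipart W d f -> Ipart W d g -> Ipart W d (f + g).
Proof. by move=> [h v] [h' v']; split; [apply: rpredD | apply: vanishD]. Qed.

Lemma IpartB W d f g : Ipart W d f -> Ipart W d g -> Ipart W d (f - g).
Proof. by move=> [h v] [h' v']; split; [apply: rpredB | apply: vanishB]. Qed.

Lemma Ipart_kdiff W d T (c : {set 'I_n.+1} -> S) :
  (forall k, k \notin T -> Ipart W d (c (k |: T))) -> Ipart W d.+1 (kdiff c T).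
Proof.
move=> h; split=> [|w Ww].
  apply: rpred_sum => k kT; rewrite -signr_odd.
  have hX : 'X_k * c (k |: T) \is d.+1.-homog.
    have hk : ('X_k : S) \is 1.-homog by rewrite dhomogX /= mdeg1.
    by have := dhomogM hk (h k kT).1; rewrite add1n.
  by case: odd; rewrite ?expr1 ?expr0 ?mulN1r ?mul1r ?rpredN.
rewrite raddf_sum big1 // => k kT /=; rewrite !mevalM (h k kT).2 //.
by rewrite !mulr0.
Qed.

Lemma chainP W i d (c : {set 'I_n.+1} -> S) :
  (forall A, #|A| = i -> Ipart W d (c A)) -> (forall A, #|A| != i -> c A = 0) ->
  chain W i d c.
Proof. by move=> h h0 A; split=> [/h//|/eqP/h0]. Qed.

Lemma chain_Ipart W i d (c : {set 'I_n.+1} -> S) A : chain W i d c -> Ipart W d (c A).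
Proof.
move=> ch; have [/(ch A).1//|/eqP/(ch A).2 ->] := eqVneq #|A| i.
exact: Ipart0.
Qed.

Definition level i (c : {set 'I_n.+1} -> S) A : S := if #|A| == i then c A else 0.

Lemma chain_level W i d c :
  (forall A, #|A| = i -> Ipart W d (c A)) -> chain W i d (level i c).
Proof.
move=> h; apply: chainP => A Ai; rewrite /level; last by rewrite (negPf Ai).
by rewrite Ai eqxx; apply: h.
Qed.

Lemma kdiff_level i c T : #|T|.+1 = i -> kdiff (level i c) T = kdiff c T.
Proof.
move=> Ti; apply: kdiff_ext => k kT.
by rewrite /level cardsU1 kT add1n Ti eqxx.
Qed.

Lemma chain_choice i (P : S -> S -> Prop) (c : {set 'I_n.+1} -> S) :
  (forall A, #|A| = i -> exists u, P u (c A)) ->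
  exists u : {set 'I_n.+1} -> S,
   (forall A, #|A| = i -> P (u A) (c A)) /\ (forall A, #|A| != i -> u A = 0).
Proof.
move=> h.
have /choice[u hu] : forall A, exists a, (#|A| = i -> P a (c A)) /\ (#|A| != i -> a = 0).
  move=> A; have [Ai|Ai] := eqVneq #|A| i; last by exists 0; split=> // /eqP; rewrite (negPf Ai).
  by have [a ha] := h A Ai; exists a.
by exists u; split=> A; have [] := hu A.
Qed.

(** By [slope], [I(W)] modulo the ideal of the cylinder is [I(B)] modulo that same ideal, shifted by
    one degree; hence the bound for [B] is one smaller. A single chase on chains does the work of
    the two long exact Tor sequences. *)
Theorem reg_cyl W B z m : cone W -> cone B ->
  (forall d f, f \is d.-homog -> vanish (cyl W z) f -> vanish B f) ->
  (forall u, vanish B u -> exists f, slope W z u f) ->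
  (forall d f, f \is d.-homog -> vanish W f -> exists u, vanish B u /\ slope W z u f) ->
  reg_le B m -> reg_le (cyl W z) m.+1 -> reg_le W m.+1.
Proof.
move=> cW cB sub lift down regB regC i d0 ltmd c chc cyc.
case: d0 ltmd chc => [//|d1]; rewrite ltnS => ltmd chc.
case: d1 ltmd chc => [//|d] ltmd chc.
have liftH e u : Ipart B e u -> exists f, Ipart W e.+1 f /\ slope W z u f.
  move=> [hu /lift[f hf]]; exists (pihomog mdeg e.+1 f).
  have := slope_homog e cW hf; rewrite (pihomog_dE hu) => hf'.
  by split=> //; split; [exact: pihomogP | exact: slope_vanish hf'].
have downH e f : Ipart W e.+1 f -> exists u, Ipart B e u /\ slope W z u f.
  move=> [hf /(down _ _ hf)[u [Bu hu]]]; exists (pihomog mdeg e u).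
  split; first by split; [exact: pihomogP | exact: vanish_homog].
  by rewrite -(pihomog_dE hf); apply: slope_homog.
have subH e f : Ipart (cyl W z) e f -> Ipart B e f.
  by move=> [hf vf]; split=> //; apply: sub hf vf.
have subW e f : Ipart (cyl W z) e f -> Ipart W e f.
  by move=> [hf vf]; split=> // w Ww; apply: vf; apply: sub_cyl.
have [u [uP u0]] : exists u : {set 'I_n.+1} -> S,
   (forall A, #|A| = i -> Ipart B d.+1 (u A) /\ slope W z (u A) (c A)) /\
   (forall A, #|A| != i -> u A = 0).
  apply: (@chain_choice i (fun a b => Ipart B d.+1 a /\ slope W z a b)) => // A Ai.
  by apply: downH; apply: chain_Ipart chc.
have uc A : slope W z (u A) (c A).
  have [/uP[]//|Ai] := eqVneq #|A| i; rewrite u0 // (chc A).2; last exact/eqP.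
  exact: slope0.
have chu : chain B i d.+1 u by apply: chainP => // A /uP[].
(* The differential of [u] is a slope of the differential of [c], which is zero, so it vanishes on
   the cylinder. *)
have duC T : #|T|.+1 = i -> Ipart (cyl W z) d.+2 (kdiff u T).
  move=> Ti; split; last first.
    apply/(slope_cyl (slope_kdiff T uc)); rewrite cyc // => w _.
    by rewrite meval0.
  suff [] : Ipart B d.+2 (kdiff u T) by [].
  by apply: Ipart_kdiff => k _; apply: chain_Ipart chu.
(* Correct [u] by a chain [v] of the cylinder so that [u - v] is a cycle for [B]; for [i = 0]
   nothing needs correction. *)
have [v [chv vE]] : exists v : {set 'I_n.+1} -> S, chain (cyl W z) i d.+1 v /\
    forall T, #|T|.+1 = i -> kdiff u T = kdiff v T.
  case: i duC {c chc cyc uP u0 uc chu} => [|i] duC.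
    by exists (fun=> 0); split=> // A; split=> // _; apply: Ipart0.
  have che : chain (cyl W z) i d.+2 (level i (kdiff u)).
    by apply: chain_level => A Ai; apply: duC; rewrite Ai.
  have [||v [chv vE]] := regC i d.+2 _ _ che; first by rewrite ltnS.
    by move=> T Ti; rewrite kdiff_level // kdiff_kdiff.
  exists v; split=> // T [Ti]; rewrite -vE // /level Ti eqxx //.
have chuv : chain B i d.+1 (fun A => u A - v A).
  apply: chainP => A Ai; last by rewrite u0 // (chv A).2 ?subr0 //; exact/eqP.
  by apply: IpartB; [apply: chain_Ipart chu | apply: subH; apply: chain_Ipart chv].
have [|w [chw wE]] := regB i d.+1 ltmd _ chuv.
  by move=> T Ti; rewrite kdiffB vE // subrr.
(* Lift a primitive [w] of [u - v] to [I(W)]: then [c - kdiff g] has slope [v], so it is a cycle in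
   the ideal of the cylinder, where it bounds. *)
have [g [gP g0]] : exists g : {set 'I_n.+1} -> S,
   (forall A, #|A| = i.+1 -> Ipart W d.+1 (g A) /\ slope W z (w A) (g A)) /\
   (forall A, #|A| != i.+1 -> g A = 0).
  apply: (@chain_choice i.+1 (fun a b => Ipart W d.+1 a /\ slope W z b a)) => // A Ai.
  by apply: liftH; apply: chain_Ipart chw.
have wg A : slope W z (w A) (g A).
  have [/gP[]//|Ai] := eqVneq #|A| i.+1; rewrite g0 // (chw A).2; last exact/eqP.
  exact: slope0.
have chg : chain W i.+1 d.+1 g by apply: chainP => // A /gP[].
have chr : chain (cyl W z) i d.+2 (level i (fun A => c A - kdiff g A)).
  apply: chain_level => A Ai; split.
    have [hc _] := chain_Ipart A chc.
    suff [hg _] : Ipart W d.+2 (kdiff g A) by apply: rpredB.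
    by apply: Ipart_kdiff => k _; apply: chain_Ipart chg.
  have hs : slope W z (v A) (c A - kdiff g A).
    have -> : v A = u A - kdiff w A by rewrite -wE // opprB addrCA subrr addr0.
    by apply: slopeB => //; apply: slope_kdiff.
  by have [_ vv] := chain_Ipart A chv; apply/(slope_cyl hs).
have [||b [chb bE]] := regC i d.+2 _ _ chr; first by rewrite ltnS.
  by move=> T Ti; rewrite kdiff_level // kdiffB cyc // kdiff_kdiff subr0.
exists (fun A => g A + b A); split.
  apply: chainP => A Ai; last by rewrite g0 // (chb A).2 ?addr0 //; exact/eqP.
  by apply: IpartD; [apply: chain_Ipart chg | apply: subW; apply: chain_Ipart chb].
move=> A Ai; rewrite kdiffD -bE // /level Ai eqxx addrCA subrr addr0 //.
Qed.

Lemma reg_full W m : (forall x, W x) -> reg_le W m.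
Proof.
move=> full i [//|d] _ c chc _; exists (fun=> 0); split.
  by move=> A; split=> // _; apply: Ipart0.
move=> A Ai; rewrite kdiff0; have [_ v0] := chain_Ipart A chc.
by apply: mpoly_ext => x; rewrite v0 ?meval0.
Qed.

(** * Linear forms and the regularity of linear subspaces *)

Lemma linform_eval (t : S) x : t \is 1.-homog ->
  t.@[x] = \sum_i x i * (t^`M(i)).@[fun=> 0].
Proof.
move=> ht; have := euler_eval x ht; rewrite mul1r => <-.
rewrite meval_dirder; apply: eq_bigr => i _; congr (_ * _).
have := homog_scale x 0 (homog_mderiv i ht); rewrite expr0 mul1r => <-.
by apply: meval_eq => j; rewrite mul0r.
Qed.

Lemma linform_shift (t : S) x c z : t \is 1.-homog ->
  t.@[shift x c z] = t.@[x] + c * t.@[z].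
Proof.
move=> ht; rewrite !(linform_eval _ ht) mulr_sumr -big_split.
by apply: eq_bigr => i _ /=; rewrite mulrA -mulrDl.
Qed.

(** Used with a linear projection for [lq]: a polynomial vanishing on its image then lies in [J],
    which serves as a Nullstellensatz for linear subspaces. *)
Lemma comp_sub_ideal (J : S -> Prop) (lq : n.+1.-tuple S) :
  J 0 -> (forall p q, J p -> J q -> J (p + q)) -> (forall p q, J q -> J (p * q)) ->
  (forall i, J ('X_i - tnth lq i)) -> forall p, J (p - (p \mPo lq)).
Proof.
move=> J0 JD JM JX; elim/mpoly_alg_ind => [c|i|p q Jp Jq|p q Jp Jq].
- by rewrite comp_mpolyC subrr.
- by rewrite comp_mpolyXU -tnth_nth.
- by rewrite comp_mpolyD opprD addrACA; apply: JD.
- rewrite (comp_mpoly_is_multiplicative _).1.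
  have -> : p * q - (p \mPo lq) * (q \mPo lq) =
    q * (p - (p \mPo lq)) + (p \mPo lq) * (q - (q \mPo lq)) by ring.
  by apply: (JD); apply: JM.
Qed.

Definition lin (ts : seq S) : vec -> Prop := fun v => forall t, t \in ts -> t.@[v] = 0.

Lemma cone_lin ts : (forall t, t \in ts -> t \is 1.-homog) -> cone (lin ts).
Proof.
by move=> hts w c _ Lw t tts; rewrite (homog_scale _ _ (hts t tts)) Lw // mulr0.
Qed.

(** A form [t] that vanishes on [lin ts] is dropped. Otherwise [lin ts] is the cylinder over
    [lin (t :: ts)] along some [z] with [t(z)] nonzero, and every polynomial [u] is the slope of a
    multiple of [t * u]; so [reg_cyl] applies with [B] empty. *)
Lemma reg_lin ts : (forall t, t \in ts -> t \is 1.-homog) -> reg_le (lin ts) 1.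
Proof.
elim: ts => [_|t ts IH hts]; first exact: reg_full.
have hts' t' : t' \in ts -> t' \is 1.-homog by move=> h; apply: hts; rewrite inE h orbT.
have ht : t \is 1.-homog by apply: hts; rewrite inE eqxx.
have [all0|] := pselect (forall v, lin ts v -> t.@[v] = 0).
  suff -> : lin (t :: ts) = lin ts by apply: IH.
  apply: funext => v; apply: propext; split=> [h t' tt'|h t'].
    by apply: h; rewrite inE tt' orbT.
  by rewrite inE => /predU1P[->|/h//]; apply: all0.
move=> /existsNP[z /not_implyP[Lz /eqP tz]].
have cylE : cyl (lin (t :: ts)) z = lin ts.
  apply: funext => v; apply: propext; split=> [[w [c [Lw ->]]] t' tt'|Lv].
    by rewrite linform_shift ?hts' // Lz // Lw ?inE ?tt' ?orbT // mulr0 addr0.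
  exists (shift v (- (t.@[v] / t.@[z])) z), (t.@[v] / t.@[z]).
  split; last by rewrite shiftD addNr shift0.
  move=> t'; rewrite inE => /predU1P[->|tt'].
    by rewrite linform_shift // mulNr divfK // subrr.
  by rewrite linform_shift ?hts' // (Lz t') // (Lv t') // mulr0 addr0.
apply: (@reg_cyl _ (fun=> False) z 0) => //.
- exact: cone_lin.
- by move=> d f _ _ w.
- move=> u _; exists ((t.@[z])^-1 *: t * u) => w c Lw.
  rewrite mevalM mevalZ (linform_shift _ _ _ ht) (Lw t) ?inE ?eqxx // add0r; congr (_ * _).
  by rewrite mulrC mulfK.
(* [lq] projects along [z] onto the kernel of [t]. As [f] vanishes on [W], it agrees on the cylinder
   with a multiple of [t], and [t] takes the value [c t(z)] there. *)
- move=> d f hf Wf; pose lq := [tuple 'X_i - (z i / t.@[z]) *: t | i < n.+1].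
  have [u hu] : exists u, f - (f \mPo lq) = t * u.
    apply: (@comp_sub_ideal (fun p => exists u, p = t * u)).
    + by exists 0; rewrite mulr0.
    + by move=> p q [a ->] [b ->]; exists (a + b); rewrite mulrDr.
    + by move=> p q [a ->]; exists (p * a); rewrite mulrCA.
    + move=> i; exists (z i / t.@[z])%:MP.
      by rewrite tnth_mktuple opprB addrCA subrr addr0 [RHS]mulrC mul_mpolyC.
  exists (t.@[z] *: u); split=> // w c Lw.
  have /(congr1 (meval (shift w c z))) := hu.
  rewrite mevalB comp_mpoly_meval mevalM (linform_shift _ _ _ ht) (Lw t) ?inE ?eqxx // add0r.
  have -> : (fun i => (tnth lq i).@[shift w c z]) = w.
    apply: funext => i; rewrite tnth_mktuple mevalB mevalXU mevalZ (linform_shift _ _ _ ht).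
    rewrite (Lw t) ?inE ?eqxx // add0r /shift mulrCA divfK //.
    by rewrite mulrC addrK.
  by rewrite (Wf w Lw) subr0 => ->; rewrite mevalZ mulrA.
- exact: tor_free.
- by rewrite cylE; apply: IH.
Qed.

End VanishingIdeals.

(** * Iterated derivatives *)

Section IteratedDerivatives.
Variables (R : realType) (n : nat).
Local Notation S := (Spoly R n).
Local Notation vec := ('I_n.+1 -> R).
Implicit Types (W : vec -> Prop) (u f g p q : S) (x v w z : vec) (c : R).

Lemma dirder_invP z f : (forall x c, f.@[shift x c z] = f.@[x]) <-> dirder z f = 0.
Proof.
split=> [inv|Df0 x c].
  apply: mpoly_ext => x; rewrite meval0.
  have [] := @dirder_eval0 _ _ (f - f.@[x]%:MP) x z.
    by move=> t _; rewrite mevalB mevalC inv subrr.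
  by rewrite dirderB dirderC subr0.
have E : (line f x z)^`() = 0 by rewrite deriv_line Df0 -mpolyC0 lineC.
suff -> : f.@[shift x c z] = f.@[shift x 0 z] by rewrite shift0.
have C (t : R) : (line f x z).[t] = (line f x z)`_0.
  suff -> : line f x z = ((line f x z)`_0)%:P by rewrite hornerC coefC.
  apply/polyP => -[|i]; rewrite coefC //=.
  have := congr1 (fun r : {poly R} => r`_i) E; rewrite /= coef_deriv coef0.
  by move/eqP; rewrite -mulr_natr mulf_eq0 pnatr_eq0 orbF => /eqP.
by have := C c; rewrite -(C 0) !horner_line.
Qed.

Lemma homog0_const f x y : f \is 0.-homog -> f.@[x] = f.@[y].
Proof.
move=> hf; have E w := homog_scale w 0 hf; move: (E x) (E y).
rewrite expr0 !mul1r => <- <-.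
by apply: meval_eq => i; rewrite !mul0r.
Qed.

Lemma dirder_homog0 v f : f \is 0.-homog -> dirder v f = 0.
Proof. by move=> hf; apply/dirder_invP => x c; apply: homog0_const. Qed.

(** Both sides equal the mixed second derivative, which is constant. *)
Lemma quad_sym (f : S) x y : f \is 2.-homog -> (dirder x f).@[y] = (dirder y f).@[x].
Proof.
move=> hf; have h1 v := homog_dirder v hf; have h0 v w := homog_dirder w (h1 v).
have := euler_eval y (h1 x); have := euler_eval x (h1 y); rewrite !mul1r => <- <-.
by rewrite dirder_comm; apply: homog0_const.
Qed.

Lemma quad_shift f x c z : f \is 2.-homog ->
  f.@[shift x c z] = f.@[x] + c * (dirder z f).@[x] + c ^+ 2 * f.@[z].
Proof.
move=> hf; have h1 v := homog_dirder v hf.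
have two : (2%:R : R) != 0 by rewrite pnatr_eq0.
apply: (mulfI two); rewrite -(euler_eval _ hf).
rewrite (@dirder_lin _ _ 1 c x z) => [|i]; last by rewrite mul1r.
rewrite scale1r mevalD mevalZ !linform_shift // !(euler_eval _ hf).
by rewrite (quad_sym x z hf); ring.
Qed.

Lemma iter_dirderD v k p q :
  iter k (dirder v) (p + q) = iter k (dirder v) p + iter k (dirder v) q.
Proof. by elim: k => //= k ->; rewrite dirderD. Qed.

Lemma iter_dirderZ v k c p : iter k (dirder v) (c *: p) = c *: iter k (dirder v) p.
Proof. by elim: k => //= k ->; rewrite dirderZ. Qed.

Lemma iter_dirder0 v k : iter k (dirder v) 0 = 0 :> S.
Proof. by elim: k => //= k ->; rewrite dirder0. Qed.

Lemma iter_dirderB v k p q :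
  iter k (dirder v) (p - q) = iter k (dirder v) p - iter k (dirder v) q.
Proof. by rewrite -scaleN1r iter_dirderD iter_dirderZ scaleN1r. Qed.

Lemma iter_dirder_comm v w k p :
  iter k (dirder v) (dirder w p) = dirder w (iter k (dirder v) p).
Proof. by elim: k => //= k ->; rewrite dirder_comm. Qed.

Lemma iter_iter_dirder v w k j p :
  iter k (dirder v) (iter j (dirder w) p) = iter j (dirder w) (iter k (dirder v) p).
Proof. by elim: j => //= j <-; rewrite iter_dirder_comm. Qed.

Lemma iter_dirder_homog v k e p : p \is (k + e).-homog -> iter k (dirder v) p \is e.-homog.
Proof.
elim: k p => //= k IH p hp; rewrite -iter_dirder_comm; apply: IH.
exact: homog_dirder.
Qed.

Lemma iter_dirder_big v D k p : p \is D.-homog -> (D < k)%N -> iter k (dirder v) p = 0.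
Proof.
move=> hp /subnK <-; rewrite iterD iterS [X in dirder v X]/=.
rewrite (dirder_homog0 v) ?iter_dirder0 //.
by apply: iter_dirder_homog; rewrite addn0.
Qed.

Lemma iter_euler x D k p : p \is D.-homog ->
  (iter k (dirder x) p).@[x] = (D ^_ k)%:R * p.@[x].
Proof.
elim: k D p => [|k IH] D p hp; first by rewrite mul1r.
rewrite iterSr; case: D hp => [|D] hp.
  by rewrite dirder_homog0 // iter_dirder0 meval0 mul0r.
by rewrite (IH D) ?homog_dirder // (euler_eval x hp) mulrA -natrM ffactSS mulnC.
Qed.

Lemma mcoeff_pihomog d p m : (pihomog mdeg d p)@_m = if mdeg m == d then p@_m else 0.
Proof.
elim/mpolyind: p => [|c k p _ _ IH]; first by rewrite pihomog0 mcoeff0 if_same.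
rewrite pihomogD !mcoeffD IH linearZ /= !mcoeffZ pihomogX !mcoeffX.
have [->|km] := eqVneq k m.
  by case: eqP => _; rewrite ?mcoeffX ?eqxx // mcoeff0 mulr0 addr0.
rewrite mulr0 (_ : _@_m = 0) ?mulr0 ?add0r //.
by case: ifP => _; rewrite ?mcoeff0 // mcoeffX (negPf km).
Qed.

Lemma pihomog_dirder d v p : pihomog mdeg d (dirder v p) = dirder v (pihomog mdeg d.+1 p).
Proof.
rewrite [LHS]raddf_sum; apply: eq_bigr => i _ /=; rewrite linearZ /=; congr (_ *: _).
apply/mpolyP => m; rewrite mcoeff_pihomog !mcoeff_deriv mcoeff_pihomog.
by rewrite mdegD mdeg1 addn1 eqSS; case: ifP => // _; rewrite mul0rn.
Qed.

Section Coordinate.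
Variables (z : vec) (x0 : S).
Hypothesis Dx0 : dirder z x0 = 1.

Lemma dirderXn m : dirder z (x0 ^+ m.+1) = m.+1%:R *: x0 ^+ m.
Proof.
elim: m => [|m IH]; first by rewrite expr1 Dx0 scale1r expr0.
rewrite exprS dirderM Dx0 mul1r IH -scalerAr -exprS -{1}[_ ^+ _]scale1r -scalerDl.
by rewrite addrC natr1.
Qed.

Lemma iter_dirder_pow m g : dirder z g = 0 -> iter m (dirder z) (x0 ^+ m * g) = m`!%:R *: g.
Proof.
move=> Dg; elim: m => [|m IH]; first by rewrite expr0 mul1r scale1r.
rewrite iterSr dirderM Dg mulr0 addr0 dirderXn -scalerAl iter_dirderZ IH scalerA.
by rewrite -natrM factS.
Qed.

(** Here [g] may itself be of first order along [z], so that [x0 ^+ m * g] has degree up to [m.+1]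
    in that direction. *)
Lemma iter_dirder_pow1 m g : dirder z (dirder z g) = 0 ->
  iter m.+1 (dirder z) (x0 ^+ m * g) = m.+1`!%:R *: dirder z g.
Proof.
move=> Dg; elim: m => [|m IH]; first by rewrite expr0 mul1r scale1r.
rewrite iterSr dirderM dirderXn -scalerAl iter_dirderD iter_dirderZ IH.
rewrite (iter_dirder_pow m.+1 Dg) scalerA -scalerDl -natrM -natrD.
by rewrite (factS m.+1) [in RHS]mulSn addnC.
Qed.

End Coordinate.

(** Vanishing to order [e] at [z], that is, membership in the [e]-th power of the ideal of that
    point of affine space. *)
Fixpoint order_ge z e f : Prop :=
  if e is e'.+1 then f.@[z] = 0 /\ forall v, order_ge z e' (dirder v f) else True.

Lemma order_geW z e f : order_ge z e.+1 f -> order_ge z e f.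
Proof. by elim: e f => // e IH f [f0 h]; split=> // v; apply: IH; apply: h. Qed.

Lemma order_geD z e f g : order_ge z e f -> order_ge z e g -> order_ge z e (f + g).
Proof.
elim: e f g => // e IH f g [f0 hf] [g0 hg]; split; first by rewrite mevalD f0 g0 addr0.
by move=> v; rewrite dirderD; apply: IH; [apply: hf | apply: hg].
Qed.

Lemma order_ge0 z e : order_ge z e 0.
Proof. by elim: e => // e IH; split=> [|v]; rewrite ?meval0 ?dirder0. Qed.

Lemma order_ge_sum z e (I : Type) (r : seq I) (P : pred I) (F : I -> S) :
  (forall i, P i -> order_ge z e (F i)) -> order_ge z e (\sum_(i <- r | P i) F i).
Proof. by move=> h; apply: big_ind => //; [apply: order_ge0 | move=> *; apply: order_geD]. Qed.

Lemma order_geM z e p f : order_ge z e f -> order_ge z e (p * f).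
Proof.
elim: e p f => // e IH p f hf; split; first by rewrite mevalM hf.1 mulr0.
move=> v; rewrite dirderM; apply: order_geD; first by apply: IH; apply: order_geW hf.
by apply: IH; apply: hf.2.
Qed.

Lemma order_geMS z e p f : p.@[z] = 0 -> order_ge z e f -> order_ge z e.+1 (p * f).
Proof.
elim: e p f => [|e IH] p f p0 hf; first by split=> //; rewrite mevalM p0 mul0r.
split; first by rewrite mevalM p0 mul0r.
move=> v; rewrite dirderM; apply: order_geD; first exact: order_geM.
by apply: IH => //; apply: hf.2.
Qed.

Lemma order_ge_iter z e k v f : order_ge z e f -> (k < e)%N -> (iter k (dirder v) f).@[z] = 0.
Proof.
elim: k e f => [|k IH] [|e] f //; first by case.
by move=> [_ h] ke; rewrite iterSr; apply: IH (h v) ke.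
Qed.

(** By Euler, [D_z^(d+1) f] at [z] is [f(z)] times a falling factorial, nonzero when the degree
    exceeds [d]. Derivatives lower the degree by one and keep the hypothesis. *)
Lemma order_ge_homog z d e f : f \is (d + e).-homog -> iter d.+1 (dirder z) f = 0 ->
  order_ge z e f.
Proof.
elim: e f => // e IH f hf D0; split; last first.
  move=> v; apply: IH; first by apply: homog_dirder; rewrite -addnS.
  by rewrite iter_dirder_comm D0 dirder0.
have /eqP := iter_euler z d.+1 hf; rewrite D0 meval0 eq_sym mulf_eq0 pnatr_eq0.
by rewrite -leqn0 leqNgt ffact_gt0 addnS ltnS leq_addr /= => /eqP.
Qed.

End IteratedDerivatives.

(** * Projection from a point *)

Section Jacobians.
Variables (R : realType) (n : nat).
Local Notation S := (Spoly R n).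
Local Notation vec := ('I_n.+1 -> R).
Implicit Types (W : vec -> Prop) (f : S) (y v : vec).

Definition jacmx k (F : 'I_k -> S) (V : 'I_k -> vec) : 'M[S]_k :=
  \matrix_(i, j) dirder (V j) (F i).

Definition jac k (F : 'I_k -> S) (V : 'I_k -> vec) y : R :=
  \det (map_mx (meval y) (jacmx F V)).

(** A nonzero minor of the differentials at [y] of the quadrics in [I(W)]. By [quad_sym] their rank
    is the dimension of the space of forms [D_y Q]. *)
Definition rank_ge W y k := exists (Q : 'I_k -> S) (V : 'I_k -> vec),
  (forall i, Ipart W 2 (Q i)) /\ jac Q V y != 0.

Lemma jacE k (F : 'I_k -> S) (V : 'I_k -> vec) y : jac F V y = (\det (jacmx F V)).@[y].
Proof. by rewrite /jac det_map_mx. Qed.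

Lemma rank_ge_bound W y k : rank_ge W y k -> (k <= n.+1)%N.
Proof.
move=> [Q [V [_]]]; apply: contraR; rewrite -ltnNge => kn.
pose A : 'M[R]_(k, n.+1) := \matrix_(i, l) ((Q i)^`M(l)).@[y].
pose C : 'M[R]_(n.+1, k) := \matrix_(l, j) V j l.
have E : map_mx (meval y) (jacmx Q V) = A *m C.
  apply/matrixP => i j; rewrite !mxE meval_dirder; apply: eq_bigr => l _.
  by rewrite !mxE mulrC.
apply: contraT; rewrite /jac E -unitfE -unitmxE -row_free_unit /row_free => /eqP r.
have := leq_trans (mxrankM_maxl A C) (rank_leq_col A).
by rewrite r leqNgt kn.
Qed.

Definition snoc (T : Type) k (F : 'I_k -> T) (a : T) (i : 'I_k.+1) : T :=
  if unlift ord_max i is Some j then F j else a.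

Lemma snoc_lift T k (F : 'I_k -> T) a i : snoc F a (lift ord_max i) = F i.
Proof. by rewrite /snoc liftK. Qed.

Lemma snoc_max T k (F : 'I_k -> T) a : snoc F a ord_max = a.
Proof. by rewrite /snoc unlift_none. Qed.

(* Expanding the bordered Jacobian determinant along its last row exhibits it
   as a vector field applied to [f]. *)
Lemma jac_snoc k (Q : 'I_k -> S) (V : 'I_k -> vec) v :
  exists c : 'I_k.+1 -> S,
    (forall f, \det (jacmx (snoc Q f) (snoc V v)) =
       \sum_j c j * dirder (snoc V v j) f) /\
    (forall z, (c ord_max).@[z] = jac Q V z) /\
    (forall z, (forall i, (dirder v (Q i)).@[z] = 0) ->
       forall j, j != ord_max -> (c j).@[z] = 0).
Proof.
pose A f := jacmx (snoc Q f) (snoc V v).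
have cof f j : cofactor (A f) ord_max j = cofactor (A 0) ord_max j.
  rewrite /cofactor; congr (_ * \det _); apply/matrixP => i l.
  by rewrite !mxE !snoc_lift.
exists (cofactor (A 0) ord_max); split; [|split] => [f|z|z Dv0 j jmax].
- rewrite (expand_det_row _ ord_max); apply: eq_bigr => j _.
  by rewrite !mxE snoc_max mulrC cof.
- rewrite jacE /cofactor addnn -muln2 mulnC exprM sqrrN !expr1n mul1r.
  congr (_.@[_]); congr (\det _); apply/matrixP => i l.
  by rewrite !mxE !snoc_lift.
- have [l lE] : exists l, ord_max = lift j l.
    by have [l -> _] := unlift_some jmax; exists l.
  rewrite /cofactor mevalM -det_map_mx (expand_det_col _ l) big1 ?mulr0 // => i _.
  by rewrite !mxE -lE snoc_lift snoc_max /= Dv0 mul0r.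
Qed.

End Jacobians.

(** * Descent from a cylinder to its base *)

Section Projection.
Variables (R : realType) (n : nat).
Local Notation S := (Spoly R n).
Local Notation vec := ('I_n.+1 -> R).
Variables (W : vec -> Prop) (z : vec) (k : nat) (Q : 'I_k -> S) (V : 'I_k -> vec).
Hypothesis cW : cone W.
Hypothesis tang : forall y f, W y -> vanish W f -> exists F, Ipart W 2 F /\
  forall v, (dirder v F).@[y] = (dirder v f).@[y].
Hypothesis Wz : W z.
Hypothesis z_neq0 : exists l, z l != 0.
Hypothesis IQ : forall i, Ipart W 2 (Q i).
Hypothesis jacQ : jac Q V z != 0.
Hypothesis kmax : forall y, W y -> ~ rank_ge W y k.+1.

Let polar i : S := dirder z (Q i).
Let polars : seq S := [seq polar i | i <- enum 'I_k].

Lemma polar_homog i : polar i \is 1.-homog.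
Proof. by apply: homog_dirder; have [] := IQ i. Qed.

Lemma lin_polarP v : lin polars v <-> forall i, (polar i).@[v] = 0.
Proof.
split=> [h i|h _ /mapP[i _ ->]]; last exact: h.
by apply: h; apply: map_f; rewrite mem_enum.
Qed.

(** In [Q(w + c z) = Q(w) + c D_z Q(w) + c^2 Q(z)] the outer terms vanish, and [D_z Q] is constant
    along [z] because [D_z Q(z) = 2 Q(z) = 0]. *)
Lemma slope_quad i : slope W z (polar i) (Q i).
Proof.
move=> w c Ww; have [hQ vQ] := IQ i.
have tz : (polar i).@[z] = 0 by rewrite (euler_eval z hQ) vQ // mulr0.
rewrite (quad_shift _ _ _ hQ) linform_shift ?polar_homog // tz !vQ //.
by rewrite !mulr0 !addr0 add0r.
Qed.

Lemma dirder_polar i : dirder z (polar i) = 0.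
Proof.
apply/dirder_invP => x a; rewrite linform_shift ?polar_homog //.
have [hQ vQ] := IQ i.
by rewrite (euler_eval z hQ) vQ // !mulr0 addr0.
Qed.

(** The matrix [M] of the values of [polar i] at [V j] is invertible. With [a = M^-1 polar], the map
    sending [x] to [x - sum_j a_j(x) V_j] is a projection onto the common zero set, congruent to the
    identity modulo the forms [polar i]. *)
Lemma lin_ideal u : vanish (lin polars) u -> exists s : 'I_k -> S, u = \sum_i s i * polar i.
Proof.
move=> vu; pose M := map_mx (meval z) (jacmx Q V).
have Mu : M \in unitmx by rewrite unitmxE unitfE.
pose a j : S := \sum_i (invmx M) j i *: polar i.
pose lq := [tuple 'X_l - \sum_j V j l *: a j | l < n.+1].
have /(_ u) : forall p, exists s : 'I_k -> S, p - (p \mPo lq) = \sum_i s i * polar i.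
  apply: (@comp_sub_ideal _ _ (fun p => exists s : 'I_k -> S, p = \sum_i s i * polar i)).
  - by exists (fun=> 0); rewrite big1 // => i _; rewrite mul0r.
  - move=> p q [s ->] [s' ->]; exists (fun i => s i + s' i); rewrite -big_split.
    by apply: eq_bigr => i _; rewrite mulrDl.
  - move=> p q [s ->]; exists (fun i => p * s i); rewrite mulr_sumr.
    by apply: eq_bigr => i _; rewrite mulrA.
  - move=> l; exists (fun i => (\sum_j V j l * (invmx M) j i)%:MP).
    rewrite tnth_mktuple opprB addrCA subrr addr0.
    under eq_bigr => j _ do rewrite /a scaler_sumr.
    rewrite exchange_big; apply: eq_bigr => i _ /=.
    rewrite mul_mpolyC scaler_suml; apply: eq_bigr => j _.
    by rewrite scalerA.
suff -> : u \mPo lq = 0 by rewrite subr0.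
apply: mpoly_ext => x; rewrite comp_mpoly_meval meval0; apply: vu; apply/lin_polarP => i.
rewrite (linform_eval _ (polar_homog i)).
have E l : (tnth lq l).@[x] = x l - \sum_j V j l * (a j).@[x].
  rewrite tnth_mktuple mevalB mevalXU (raddf_sum (meval x)); congr (_ - _).
  by apply: eq_bigr => j _ /=; rewrite mevalZ.
under eq_bigr => l _ do rewrite E mulrBl.
rewrite sumrB -(linform_eval _ (polar_homog i)).
under [X in _ - X]eq_bigr => l _ do rewrite mulr_suml.
rewrite exchange_big /=.
have E' j : \sum_l V j l * (a j).@[x] * ((polar i)^`M(l)).@[fun=> 0] = M i j * (a j).@[x].
  rewrite !mxE (quad_sym _ _ (IQ i).1) -/(polar i) (linform_eval _ (polar_homog i)) mulr_suml.
  by apply: eq_bigr => l _; rewrite mulrAC.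
under [X in _ - X]eq_bigr => j _ do rewrite E'.
have -> : \sum_j M i j * (a j).@[x] = (M *m invmx M *m (\col_l (polar l).@[x])) i 0.
  rewrite -mulmxA mxE; apply: eq_bigr => j _; congr (_ * _).
  by rewrite raddf_sum mxE; apply: eq_bigr => l _ /=; rewrite mevalZ mxE.
by rewrite mulmxV // mul1mx mxE subrr.
Qed.

Lemma exists_coord : exists x0 : S, x0 \is 1.-homog /\ dirder z x0 = 1.
Proof.
have [l zl] := z_neq0; exists ((z l)^-1 *: 'X_l); split.
  by apply: rpredZ; rewrite dhomogX /= mdeg1.
by rewrite dirderZ dirderX -mul_mpolyC -mpolyCM mulVf.
Qed.

(** Composition with the projection [lr] along [z] fixes [u] and the [polar i] and makes the
    coefficients constant along [z]. Then [sum_i s_i Q_i] has not only slope [u] but also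
    [z]-derivative [u]. *)
Lemma lin_ideal_inv u : vanish (lin polars) u -> dirder z u = 0 ->
  exists s : 'I_k -> S, (forall i, dirder z (s i) = 0) /\ u = \sum_i s i * polar i.
Proof.
move=> /lin_ideal[s us] Du; have [x0 [hx0 Dx0]] := exists_coord.
pose lr := [tuple 'X_l - z l *: x0 | l < n.+1].
have lrE x : (fun l => (tnth lr l).@[x]) = shift x (- x0.@[x]) z.
  apply: funext => l; rewrite tnth_mktuple mevalB mevalXU mevalZ /shift.
  by rewrite mulNr mulrC.
have x0z : x0.@[z] = 1.
  by have := euler_eval z hx0; rewrite Dx0 meval1 mul1r.
have lr_inv f : dirder z (f \mPo lr) = 0.
  apply/dirder_invP => x c; rewrite !comp_mpoly_meval !lrE.
  by rewrite linform_shift // shiftD x0z mulr1 opprD addrCA subrr addr0.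
have lr_id f : dirder z f = 0 -> f \mPo lr = f.
  move=> /dirder_invP inv; apply: mpoly_ext => x.
  by rewrite comp_mpoly_meval lrE inv.
exists (fun i => s i \mPo lr); split=> [i|]; first exact: lr_inv.
rewrite -{1}(lr_id u) // us raddf_sum; apply: eq_bigr => i _ /=.
by rewrite (comp_mpoly_is_multiplicative _).1 (lr_id (polar i)) // dirder_polar.
Qed.

Lemma lift_slope u : vanish (lin polars) u -> exists f, slope W z u f.
Proof.
move=> /lin_ideal[s ->]; exists (\sum_i s i * Q i).
by apply: slope_sum => i; apply: slopeM; apply: slope_quad.
Qed.

Lemma lift_slope_inv u : vanish (lin polars) u -> dirder z u = 0 ->
  exists f, slope W z u f /\ dirder z f = u.
Proof.
move=> vu Du; have [s [Ds us]] := lin_ideal_inv vu Du.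
exists (\sum_i s i * Q i); split.
  by rewrite us; apply: slope_sum => i; apply: slopeM; apply: slope_quad.
rewrite us dirder_sum; apply: eq_bigr => i _.
by rewrite dirderM Ds mul0r add0r.
Qed.

(** At [y] only the differential of [f] enters, so [f] may be replaced by a quadric [F] with the
    same differential; a nonzero value would then be a minor of size [k.+1], against [kmax]. *)
Lemma jac_snoc_vanish v f : vanish W f ->
  vanish W (\det (jacmx (snoc Q f) (snoc V v))).
Proof.
move=> vf y Wy; rewrite -jacE; have [F [IF DF]] := tang Wy vf.
apply/eqP; apply: contra_notT (kmax Wy) => ne0.
exists (snoc Q F), (snoc V v); split.
  move=> i; rewrite /snoc; case: unlift => // j.
apply: contraNN ne0 => /eqP e0; apply/eqP; rewrite -e0 /jac; congr (\det _).
apply/matrixP => i j; rewrite !mxE /snoc; case: (unlift ord_max i) => [i'|] /= //.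
Qed.

(* Each [v] in the common zero set of the forms [polar i] is the value at [z] of a
   vector field preserving the ideal of [W], so [f] has no leading term along [v]. *)
Lemma leading_term_vanish e f v : vanish W f -> order_ge z e f -> lin polars v ->
  (iter e (dirder v) f).@[z] = 0.
Proof.
move=> vf ordf /lin_polarP Lv; elim: e f vf ordf => [|e IH] f vf ordf; first exact: vf.
have [c [cE [cmax c0]]] := jac_snoc Q V v.
have Dv0 i : (dirder v (Q i)).@[z] = 0 by rewrite (quad_sym _ _ (IQ i).1); apply: Lv.
have := jac_snoc_vanish v vf; rewrite cE (bigD1 ord_max) //= snoc_max.
set h := \sum_(_ | _) _; set a := (c ord_max).@[z].
have a0 : a != 0 by rewrite /a cmax.
(* The vector field is [a D_v] plus a field vanishing at [z]. The latter keeps the order of [f] at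
   [e.+1], so only [a D_v f] counts in order [e]. *)
have -> : c ord_max * dirder v f + h =
    a *: dirder v f + ((c ord_max - a%:MP) * dirder v f + h).
  by rewrite mulrBl mul_mpolyC addrA addrCA subrr addr0.
set g := (_ * _ + _) => vg.
have ordg : order_ge z e.+1 g.
  have [_ hD] := ordf; apply: order_geD.
    by apply: order_geMS (hD v); rewrite mevalB mevalC subrr.
  by apply: order_ge_sum => j jmax; apply: order_geMS (hD _); apply: c0.
have := IH _ vg; rewrite iter_dirderD iter_dirderZ mevalD mevalZ.
rewrite (order_ge_iter v ordg (ltnSn e)) addr0 -iterSr => H.
have /eqP : a * (iter e.+1 (dirder v) f).@[z] = 0.
  apply: H; apply: order_geD; last exact: order_geW ordg.
  by rewrite -mul_mpolyC; apply: order_geM; apply: ordf.2.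
by rewrite mulf_eq0 (negPf a0) => /eqP.
Qed.

(** With [d + e] the degree of [f], [D_z^d D_v^e f] is a constant. Evaluated at [z] it is [d!] times
    [D_v^e f(z)], which is zero by [leading_term_vanish]; evaluated at [v] it is [e!] times
    [D_z^d f(v)]. *)
Lemma top_coef_vanish d D f : f \is D.-homog -> vanish W f -> (0 < d)%N ->
  iter d.+1 (dirder z) f = 0 -> vanish (lin polars) (iter d (dirder z) f).
Proof.
move=> hf vf d0 Df; have [Dd|] := ltnP D d.
  by rewrite (iter_dirder_big _ hf) // => w _; rewrite meval0.
move=> /subnKC dD v Lv; move: hf; rewrite -dD; set e := (D - d)%N => hf.
have := leading_term_vanish vf (order_ge_homog hf Df) Lv.
have he : iter d (dirder z) f \is e.-homog by apply: iter_dirder_homog.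
have hd : iter e (dirder v) f \is d.-homog by apply: iter_dirder_homog; rewrite addnC.
have := iter_euler z d hd; rewrite iter_iter_dirder => + E; rewrite E mulr0.
rewrite (@homog0_const _ _ _ z v); last by apply: iter_dirder_homog; rewrite addn0.
rewrite (iter_euler v e he) => /eqP; rewrite mulf_eq0 pnatr_eq0.
by rewrite -leqn0 leqNgt ffact_gt0 leqnn /= => /eqP.
Qed.

(** Induction on the degree along [z]. The top coefficient [g] lifts to [G'] in [I(W)] with slope
    [g] and [D_z G' = g]. As [G'] is already of first order along [z], subtracting [x0 ^+ d * G']
    removes the term of degree [d.+1]. *)
Lemma down_slope d D f : f \is D.-homog -> vanish W f -> iter d.+1 (dirder z) f = 0 ->
  exists u, vanish (lin polars) u /\ slope W z u f.
Proof.
have [x0 [hx0 Dx0]] := exists_coord.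
elim: d D f => [|d IH] D f hf vf Df.
  exists 0; split=> [w _|w c Ww]; rewrite meval0 // mulr0.
  by rewrite ((dirder_invP z f).2 Df) vf.
have [Dd|dD] := ltnP D d.+1.
  by apply: IH (hf) vf _; apply: iter_dirder_big hf Dd.
pose g := (d.+1)`!%:R^-1 *: iter d.+1 (dirder z) f.
have f0 : ((d.+1)`!%:R : R) != 0 by rewrite pnatr_eq0 -lt0n fact_gt0.
have Dg : dirder z g = 0 by rewrite dirderZ -iterS Df scaler0.
have vg : vanish (lin polars) g by apply/vanishZ/(top_coef_vanish hf).
have hg : g \is (D - d.+1).-homog.
  by apply: rpredZ; apply: iter_dirder_homog; rewrite subnKC.
have [G [sG DG]] : exists G, slope W z g (pihomog mdeg (D - d) G) /\
    dirder z (pihomog mdeg (D - d) G) = g.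
  have [G [sG DG]] := lift_slope_inv vg Dg; exists G.
  have -> : (D - d = (D - d.+1).+1)%N by rewrite subnSK.
  rewrite -pihomog_dirder DG (pihomog_dE hg); split=> //.
  by have := slope_homog (D - d.+1)%N cW sG; rewrite (pihomog_dE hg).
set G' := pihomog _ _ _ in sG DG.
have hxG : x0 ^+ d * G' \is D.-homog.
  have := dhomogM (dhomogMn d hx0) (pihomogP mdeg (D - d) G).
  by rewrite mul1n subnKC // ltnW.
have [||u [vu su]] := IH D (f - x0 ^+ d * G') (rpredB hf hxG).
- by apply: vanishB => //; apply: vanishM; apply: slope_vanish sG.
- rewrite iter_dirderB (iter_dirder_pow1 Dx0) ?DG //.
  by rewrite /g scalerA mulfV // scale1r subrr.
exists (u + x0 ^+ d * g); split; first by apply: vanishD => //; apply: vanishM.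
by rewrite -[f](subrK (x0 ^+ d * G')); apply: slopeD => //; apply: slopeM.
Qed.

Lemma vanish_cyl_dirder f : vanish (cyl W z) f -> vanish (cyl W z) (dirder z f).
Proof.
move=> vf w Ww; have [] // := @dirder_eval0 _ _ f w z.
move=> a _; apply: vf; have [w' [c [Ww' ->]]] := Ww.
by exists w', (c + a); rewrite -shiftD.
Qed.

(** The top coefficient along [z] again vanishes on the cylinder, which reduces to [g] constant
    along [z]; such a [g] is the top coefficient of [x0 * g], to which [top_coef_vanish] applies. *)
Lemma cyl_sub_lin d D f : f \is D.-homog -> vanish (cyl W z) f ->
  iter d.+1 (dirder z) f = 0 -> vanish (lin polars) f.
Proof.
have [x0 [hx0 Dx0]] := exists_coord.
have base e g : g \is e.-homog -> vanish (cyl W z) g -> dirder z g = 0 ->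
    vanish (lin polars) g.
  move=> hg vg Dg; have D1 : dirder z (x0 * g) = g.
    by rewrite dirderM Dx0 Dg mul1r mulr0 addr0.
  rewrite -D1; apply: (@top_coef_vanish 1 (1 + e)) => //; last by rewrite /= D1.
    exact: dhomogM.
  by apply: vanishM => w Ww; apply: vg; apply: sub_cyl.
elim: d D f => [|d IH] D f hf vf Df; first exact: base hf vf Df.
have [Dd|dD] := ltnP D d.+1.
  by apply: IH (hf) vf _; apply: iter_dirder_big hf Dd.
pose g := (d.+1)`!%:R^-1 *: iter d.+1 (dirder z) f.
have f0 : ((d.+1)`!%:R : R) != 0 by rewrite pnatr_eq0 -lt0n fact_gt0.
have Dg : dirder z g = 0 by rewrite dirderZ -iterS Df scaler0.
have hg : g \is (D - d.+1).-homog.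
  by apply: rpredZ; apply: iter_dirder_homog; rewrite subnKC.
have vg : vanish (cyl W z) g.
  by apply: vanishZ; elim: (d.+1) => //= m; apply: vanish_cyl_dirder.
have hxg : x0 ^+ d.+1 * g \is D.-homog.
  by have := dhomogM (dhomogMn d.+1 hx0) hg; rewrite mul1n subnKC.
rewrite -[f](subrK (x0 ^+ d.+1 * g)); apply: vanishD.
  apply: (IH D); first exact: rpredB.
    by apply: vanishB => //; apply: vanishM.
  rewrite iter_dirderB (iter_dirder_pow Dx0) //.
  by rewrite /g scalerA mulfV // scale1r subrr.
by apply: vanishM; apply: base hg vg Dg.
Qed.

Theorem reg_le2_cyl : reg_le (cyl W z) 2 -> reg_le W 2.
Proof.
have hts t : t \in polars -> t \is 1.-homog by move=> /mapP[i _ ->]; apply: polar_homog.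
have big D f : f \is D.-homog -> iter D.+1 (dirder z) f = 0.
  by move=> hf; apply: iter_dirder_big hf _.
apply: (@reg_cyl _ _ W (lin polars) z 1) => //.
- exact: cone_lin.
- by move=> D f hf vf; apply: cyl_sub_lin hf vf (big _ _ hf).
- exact: lift_slope.
- by move=> D f hf vf; apply: down_slope hf vf (big _ _ hf).
- exact: reg_lin.
Qed.

End Projection.

(** * Positive semidefinite matrices *)

Section PositiveSemidefinite.
Variables (R : realType) (m : nat).
Implicit Types (A B M P Q : 'M[R]_m) (v w y : 'rV[R]_m).

Definition bf A v w : R := (v *m A *m w^T) 0 0.
Definition qf A v : R := bf A v v.
Definition psdmx A := A^T = A /\ forall v, 0 <= qf A v.

Lemma bfE A v w : bf A v w = \sum_i \sum_j v 0 i * A i j * w 0 j.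
Proof.
rewrite /bf mxE exchange_big; apply: eq_bigr => j _ /=.
by rewrite !mxE mulr_suml.
Qed.

Lemma bfDA A B v w : bf (A + B) v w = bf A v w + bf B v w.
Proof. by rewrite /bf mulmxDr mulmxDl mxE. Qed.

Lemma bfZA (c : R) A v w : bf (c *: A) v w = c * bf A v w.
Proof. by rewrite /bf -scalemxAr -scalemxAl mxE. Qed.

Lemma bfNA A v w : bf (- A) v w = - bf A v w.
Proof. by rewrite -scaleN1r bfZA mulN1r. Qed.

Lemma bfDl A v v' w : bf A (v + v') w = bf A v w + bf A v' w.
Proof. by rewrite /bf !mulmxDl mxE. Qed.

Lemma bfDr A v w w' : bf A v (w + w') = bf A v w + bf A v w'.
Proof. by rewrite /bf linearD /= mulmxDr mxE. Qed.

Lemma bfZl (c : R) A v w : bf A (c *: v) w = c * bf A v w.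
Proof. by rewrite /bf -!scalemxAl mxE. Qed.

Lemma bfZr (c : R) A v w : bf A v (c *: w) = c * bf A v w.
Proof. by rewrite /bf linearZ /= -scalemxAr mxE. Qed.

Lemma bf_sym A v w : A^T = A -> bf A v w = bf A w v.
Proof.
move=> sA; have -> : bf A w v = (w *m A *m v^T) 0 0 by [].
have -> : w *m A *m v^T = (v *m A *m w^T)^T by rewrite !trmx_mul trmxK sA mulmxA.
by rewrite [RHS]mxE.
Qed.

Lemma qfD A B v : qf (A + B) v = qf A v + qf B v.
Proof. exact: bfDA. Qed.

Lemma qfZ (c : R) A v : qf (c *: A) v = c * qf A v.
Proof. exact: bfZA. Qed.

Lemma qfN A v : qf (- A) v = - qf A v.
Proof. exact: bfNA. Qed.

Lemma qfB A B v : qf (A - B) v = qf A v - qf B v.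
Proof. by rewrite qfD qfN. Qed.

Lemma sqnormE v : qf 1%:M v = \sum_i v 0 i ^+ 2.
Proof.
rewrite /qf /bf mulmx1 mxE; apply: eq_bigr => i _.
by rewrite mxE expr2.
Qed.

Lemma sqnorm_ge0 v : 0 <= qf 1%:M v.
Proof. by rewrite sqnormE; apply: sumr_ge0 => i _; apply: sqr_ge0. Qed.

Lemma sqnorm_eq0 v : qf 1%:M v = 0 -> v = 0.
Proof.
rewrite sqnormE => /eqP; rewrite psumr_eq0 => [/allP h|i _]; last exact: sqr_ge0.
apply/rowP => i; rewrite mxE; apply/eqP; rewrite -sqrf_eq0.
by apply: (h i); rewrite mem_index_enum.
Qed.

Lemma bf1E v w : bf 1%:M v w = (v *m w^T) 0 0.
Proof. by rewrite /bf mulmx1. Qed.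

Lemma cauchy_schwarz A v w : psdmx A -> (bf A v w) ^+ 2 <= qf A v * qf A w.
Proof.
move=> [sA pA]; have E t : qf A (v + t *: w) = qf A v + 2 * t * bf A v w + t ^+ 2 * qf A w.
  rewrite /qf !bfDl !bfDr !bfZl !bfZr (bf_sym w v sA); ring.
have [w0|w0] := eqVneq (qf A w) 0.
  rewrite w0 mulr0; have [->|b0] := eqVneq (bf A v w) 0; first by rewrite expr0n.
  (* The form is affine in [t] here, and this [t] gives it the value -1. *)
  have := pA (v + (- (qf A v + 1) / (2 * bf A v w)) *: w); rewrite E w0 mulr0 addr0.
  have -> : 2 * (- (qf A v + 1) / (2 * bf A v w)) * bf A v w = - (qf A v + 1) by field.
  by lra.
have {w0} w0 : 0 < qf A w by rewrite lt_neqAle eq_sym w0 pA.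
have := pA (v + (- bf A v w / qf A w) *: w); rewrite E.
have -> : qf A v + 2 * (- bf A v w / qf A w) * bf A v w +
   (- bf A v w / qf A w) ^+ 2 * qf A w = (qf A v * qf A w - bf A v w ^+ 2) / qf A w.
  by field; apply: lt0r_neq0.
by rewrite pmulr_lge0 ?invr_gt0 // subr_ge0.
Qed.

Lemma psd_ker A v : psdmx A -> qf A v = 0 -> v *m A = 0.
Proof.
move=> pA v0; apply: sqnorm_eq0; have := cauchy_schwarz v (v *m A) pA.
rewrite v0 mul0r /bf -bf1E => h; apply/eqP; rewrite -sqrf_eq0 eq_le h.
exact: sqr_ge0.
Qed.

Lemma psd_eq0 A : psdmx A -> (forall v, qf A v = 0) -> A = 0.
Proof.
move=> pA h; apply/row_matrixP => i; rewrite row0 rowE.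
by apply: psd_ker => //; apply: h.
Qed.

Lemma psd_neq0 A : psdmx A -> A != 0 -> exists v, 0 < qf A v.
Proof.
move=> pA A0; have [//|h] := pselect (exists v, 0 < qf A v).
case/eqP: A0; apply: psd_eq0 => // v; apply/eqP; rewrite eq_le pA.2 andbT leNgt.
by apply/negP => v0; apply: h; exists v.
Qed.

Lemma qf_bounded A : exists C, 0 <= C /\ forall v, qf A v <= C * qf 1%:M v.
Proof.
exists (\sum_i \sum_j `|A i j|); split.
  by do 2! (apply: sumr_ge0 => ? _).
move=> v; rewrite /qf bfE mulr_suml; apply: ler_sum => i _.
rewrite mulr_suml; apply: ler_sum => j _.
have le1 l : v 0 l ^+ 2 <= bf 1%:M v v.
  rewrite -/(qf _ _) sqnormE (bigD1 l) //= lerDl.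
  by apply: sumr_ge0 => k _; apply: sqr_ge0.
have : `|v 0 i * v 0 j| <= bf 1%:M v v.
  rewrite ler_norml; have := le1 i; have := le1 j.
  have := sqr_ge0 (v 0 i + v 0 j); have := sqr_ge0 (v 0 i - v 0 j).
  by move=> *; apply/andP; split; nra.
move=> h; apply: le_trans (ler_norm _) _.
by rewrite mulrAC normrM mulrC ler_wpM2l.
Qed.

(** Symmetry and the inclusion of row spaces give [A = P D P]; so [qf A v] is at most a multiple of
    [|v P|^2], which Cauchy-Schwarz bounds by a multiple of [qf P v]. *)
Lemma qf_dominated P A : psdmx P -> A^T = A -> (A <= P)%MS ->
  exists C, 0 <= C /\ forall v, qf A v <= C * qf P v.
Proof.
move=> pP sA AP; have sP := pP.1.
have [X e1] : exists X, A *m X *m P = A by exists (pinvmx P); apply: mulmxKpV.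
pose D := X^T *m A *m X.
have AE : A = P *m D *m P.
  have e2 : P *m X^T *m A = A.
    by have := congr1 trmx e1; rewrite !trmx_mul sP sA mulmxA.
  by rewrite /D !mulmxA e2 e1.
have [C [C0 hC]] := qf_bounded D; have [C' [C'0 hC']] := qf_bounded P.
have vP v : qf 1%:M (v *m P) <= C' * qf P v.
  have := cauchy_schwarz v (v *m P) pP; rewrite {1}/bf -bf1E -/(qf _ _) => h.
  have := hC' (v *m P); have := sqnorm_ge0 (v *m P); have := pP.2 v.
  set a := qf 1%:M _ in h *; set b := qf P v in h *; set c := qf P _ in h *.
  move=> b0 a0 ca; have [->|an0] := eqVneq a 0; first exact: mulr_ge0.
  have {an0} a0' : 0 < a by rewrite lt_neqAle eq_sym an0.
  rewrite -(ler_pM2r a0') -expr2; apply: le_trans h _.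
  by rewrite mulrAC [X in X <= _]mulrC ler_wpM2r.
exists (C * C'); split; first exact: mulr_ge0.
move=> v; have -> : qf A v = qf D (v *m P).
  by rewrite /qf /bf AE trmx_mul sP !mulmxA.
by apply: le_trans (hC _) _; rewrite -mulrA ler_wpM2l.
Qed.

(** A vector in the kernel of [M] is isotropic for [A], since [0 <= A <= M], hence lies in the
    kernel of [A]. *)
Lemma psd_sub A M : psdmx A -> psdmx (M - A) -> (A <= M)%MS.
Proof.
move=> pA pMA; have sM : M^T = M by rewrite -(subrK A M) linearD /= pMA.1 pA.1.
rewrite submxE; suff : (cokermx M)^T *m A = 0.
  by move/(congr1 trmx); rewrite trmx_mul trmxK pA.1 trmx0 => ->.
have uM : (cokermx M)^T *m M = 0.
  by apply: trmx_inj; rewrite trmx_mul trmxK sM trmx0 mulmx_coker.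
apply/row_matrixP => i; rewrite row0 row_mul; apply: psd_ker => //.
apply/eqP; rewrite eq_le pA.2 andbT.
have := pMA.2 (row i (cokermx M)^T); rewrite qfB.
rewrite {1}/qf /bf -row_mul uM row0 mul0mx mxE sub0r oppr_ge0.
by [].
Qed.

(** Take the largest multiple of [B] that can be subtracted: were the row space of [B] still inside
    that of the remainder, [qf_dominated] would allow a little more. *)
Lemma psd_max_sub A B : psdmx A -> psdmx B -> B != 0 ->
  exists t, 0 <= t /\ psdmx (A - t *: B) /\ ~~ (B <= A - t *: B)%MS.
Proof.
move=> pA pB B0; have [v0 v0P] := psd_neq0 pB B0.
have sAB t : (A - t *: B)^T = A - t *: B by rewrite linearB linearZ /= pA.1 pB.1.
pose E : classical_sets.set R := fun t => 0 <= t /\ psdmx (A - t *: B).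
have E0 : E 0 by split=> //; rewrite scale0r subr0.
have ubE t : E t -> t <= qf A v0 / qf B v0.
  by move=> [_ [_ /(_ v0)]]; rewrite qfB qfZ subr_ge0 ler_pdivlMr.
have supE : classical_sets.has_sup E by split; [exists 0 | exists (qf A v0 / qf B v0) => t /ubE].
have leE t : E t -> t <= sup E by apply: sup_upper_bound.
have psup : psdmx (A - sup E *: B).
  split=> // v; rewrite qfB qfZ subr_ge0.
  have [Bv|Bv] := eqVneq (qf B v) 0; first by rewrite Bv mulr0 pA.2.
  have {Bv} Bv : 0 < qf B v by rewrite lt_neqAle eq_sym Bv pB.2.
  rewrite -ler_pdivlMr //; apply: ge_sup; first by exists 0.
  by move=> t [_ [_ /(_ v)]]; rewrite qfB qfZ subr_ge0 ler_pdivlMr.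
exists (sup E); split; first exact: leE.
split=> //; apply/negP => /(qf_dominated psup pB.1)[C [C0 hC]].
have C1 : 0 < C + 1 by rewrite ltr_wpDl.
have : E (sup E + (C + 1)^-1).
  split; first by apply: addr_ge0; [exact: leE | rewrite invr_ge0 ltW].
  split=> // v; have := hC v; have := psup.2 v; have := pB.2 v; rewrite !qfB !qfZ => b0 p h.
  have : (C + 1)^-1 * qf B v <= qf A v - sup E * qf B v.
    rewrite mulrC ler_pdivrMr //; nra.
  by lra.
by move/leE; rewrite gerDl leNgt invr_gt0 C1.
Qed.

Lemma rank1_psd M : psdmx M -> \rank M = 1%N -> exists y, M = y^T *m y.
Proof.
move=> pM r1; have M0 : M != 0 by rewrite -mxrank_eq0 r1.
have [i Mi] : exists i, M i i != 0.
  have [//|h] := pselect (exists i, M i i != 0); case/eqP: M0.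
  apply/row_matrixP => i; rewrite row0 rowE; apply: psd_ker => //.
  rewrite /qf /bf -rowE; apply/eqP; apply: contra_notT h => h; exists i.
  apply: contraNN h => /eqP Mi; apply/eqP; rewrite mxE (bigD1 i) //= big1.
    by rewrite !mxE Mi mul0r add0r.
  by move=> j /negPf ji; rewrite !mxE ji andbF mulr0.
have Mi0 : 0 < M i i.
  rewrite lt_neqAle eq_sym Mi; have := pM.2 (delta_mx 0 i).
  rewrite /qf /bf -rowE mxE (bigD1 i) //= big1; last first.
    by move=> j /negPf ji; rewrite !mxE ji andbF mulr0.
  by rewrite !mxE !eqxx mulr1 addr0.
have rowM j : exists c, row j M = c *: row i M.
  apply/sub_rVP; apply: submx_trans (row_sub j M) _.
  have [_] := mxrank_leqif_sup (row_sub i M); rewrite r1 => <-.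
  rewrite rank_rV; suff -> : row i M != 0 by [].
  by apply: contraNneq Mi => /rowP/(_ i); rewrite !mxE => ->.
exists ((Num.sqrt (M i i))^-1 *: row i M); apply/matrixP => j k.
rewrite !mxE big_ord1 !mxE mulrACA -invfM -expr2 sqr_sqrtr ?ltW //.
have [c /rowP jE] := rowM j; have := jE k; have := jE i; rewrite !mxE => Eji ->.
have -> : M i j = M j i by rewrite -[in LHS]pM.1 mxE.
by rewrite Eji; field.
Qed.

(** * Duality for a cone of psd matrices with rank-one extreme rays *)

Section ExtremeRays.
Variable L : 'M[R]_m -> Prop.
Hypothesis L_lin : forall c A B, L A -> L B -> L (c *: A + B).
Hypothesis L_ext : forall M, L M -> psdmx M -> M != 0 ->
  (forall A B, L A -> L B -> psdmx A -> psdmx B -> M = A + B ->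
    (exists c : R, 0 <= c /\ A = c *: M) /\ (exists c : R, 0 <= c /\ B = c *: M)) ->
  \rank M = 1%N.

Lemma L_B A B : L A -> L B -> L (A - B).
Proof. by move=> LA LB; rewrite addrC -scaleN1r; apply: L_lin. Qed.

Lemma L_Z c A : L A -> L (c *: A).
Proof.
by move=> LA; rewrite -[_ *: _]addr0 -(subrr A); apply: L_lin => //; apply: L_B.
Qed.

(* Krein-Milman for the cone of psd matrices in [L], in dual form. *)
Theorem tr_ge0 Q M : (forall y, L (y^T *m y) -> 0 <= qf Q y) ->
  L M -> psdmx M -> 0 <= \tr (Q *m M).
Proof.
move=> hQ; have [r] := ubnP (\rank M); elim: r M => // r IH M; rewrite ltnS => rM LM pM.
have [->|M0] := eqVneq M 0; first by rewrite mulmx0 mxtrace0.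
have [hE|] := pselect (forall A B, L A -> L B -> psdmx A -> psdmx B -> M = A + B ->
    (exists c : R, 0 <= c /\ A = c *: M) /\ (exists c : R, 0 <= c /\ B = c *: M)).
  have [y yE] := rank1_psd pM (L_ext LM pM M0 hE).
  have := hQ y; rewrite -yE => /(_ LM); rewrite yE mulmxA mxtrace_mulC mulmxA.
  by rewrite /qf /bf /mxtrace big_ord1.
move=> /existsNP[A0 /existsNP[B0 H0]].
have [a [La [pa [pMa nprop]]]] :
    exists a, L a /\ psdmx a /\ psdmx (M - a) /\ ~ exists c : R, 0 <= c /\ a = c *: M.
  move: A0 B0 H0 => A B H.
  have [LA|h] := pselect (L A); last by case: H.
  have [LB|h] := pselect (L B); last by case: H.
  have [pA|h] := pselect (psdmx A); last by case: H.
  have [pB|h] := pselect (psdmx B); last by case: H.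
  have [ME|h] := pselect (M = A + B); last by case: H.
  have [pA'|?] := pselect (exists c : R, 0 <= c /\ A = c *: M).
    have [pB'|?] := pselect (exists c : R, 0 <= c /\ B = c *: M); first by case: H.
    by exists B; do 2! split=> //; split=> //; rewrite ME addrK.
  by exists A; do 2! split=> //; split=> //; rewrite ME addrAC subrr add0r.
have a0 : a != 0.
  by apply/eqP => a0; apply: nprop; exists 0; rewrite scale0r.
have aM : (a <= M)%MS by apply: psd_sub.
(* Subtracting [a] from [M], and [M] from [a], as far as possible leaves two remainders of rank
   below that of [M], to which the induction applies. *)
have [t [t0 [pMt nMt]]] := psd_max_sub pM pa a0.
have [u [u0 [pau nau]]] := psd_max_sub pa pM M0.
have r1 : (\rank (M - t *: a)%R < r)%N.
  apply: leq_trans rM; apply: rank_ltmx; rewrite ltmxE.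
  apply/andP; split; first by apply: addmx_sub => //; rewrite eqmx_opp scalemx_sub.
  by apply: contra nMt; apply: submx_trans.
have r2 : (\rank (a - u *: M)%R < r)%N.
  apply: leq_trans rM; apply: rank_ltmx; rewrite ltmxE nau andbT.
  by apply: addmx_sub => //; rewrite eqmx_opp scalemx_sub.
have h1 : 0 <= \tr (Q *m (M - t *: a)) by apply: IH => //; apply: L_B => //; apply: L_Z.
have h2 : 0 <= \tr (Q *m (a - u *: M)) by apply: IH => //; apply: L_B => //; apply: L_Z.
have Mt0 : M - t *: a != 0.
  apply: contra_notN nprop => /eqP/subr0_eq ME.
  have tn0 : t != 0 by apply: contraNneq M0 => t00; rewrite ME t00 scale0r.
  by exists t^-1; rewrite invr_ge0 ME scalerA mulVf // scale1r.
have E : (1 - t * u) *: M = (M - t *: a) + t *: (a - u *: M).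
  by rewrite scalerBr scalerBl scale1r scalerA addrA subrK.
(* The right side of [E] is a nonzero psd matrix plus a psd one. *)
have tu : 0 < 1 - t * u.
  have [v v0] := psd_neq0 pMt Mt0; have := congr1 (fun A => qf A v) E.
  rewrite /= qfZ qfD qfZ => Ev.
  have : 0 < (1 - t * u) * qf M v.
    by rewrite Ev ltr_wpDr // mulr_ge0 // pau.2.
  by have := pM.2 v; nra.
have := congr1 (fun A => \tr (Q *m A)) E.
rewrite /= mulmxDr -!scalemxAr mxtraceD !mxtraceZ => Et.
have : 0 <= (1 - t * u) * \tr (Q *m M) by rewrite Et addr_ge0 // mulr_ge0.
by rewrite pmulr_rge0.
Qed.

End ExtremeRays.

End PositiveSemidefinite.

Lemma qf_mulr (R : realType) m k (P : 'M[R]_(m, k)) (v : 'rV_m) :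
  qf (P *m P^T) v = qf 1%:M (v *m P).
Proof. by rewrite /qf /bf mulmx1 trmx_mul !mulmxA. Qed.

(** * Quadrics and linear spaces of symmetric matrices *)

Section Separation.
Variable R : realType.

Lemma subspace_mx d (P : 'rV[R]_d -> Prop) :
  P 0 -> (forall c u v, P u -> P v -> P (c *: u + v)) ->
  exists G : 'M[R]_d, forall u, P u <-> (u <= G)%MS.
Proof.
move=> P0 Plin.
pose good k := exists G : 'M[R]_d, (forall u : 'rV_d, (u <= G)%MS -> P u) /\ \rank G = k.
have ex0 : exists k, `[< good k >].
  exists 0%N; apply/asboolP; exists 0; split; last exact: mxrank0.
  by move=> u; rewrite submx0 => /eqP ->.
have bnd k : `[< good k >] -> (k <= d)%N.
  by move=> /asboolP[G [_ <-]]; apply: rank_leq_row.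
have [_ /asboolP[G [GP <-]] maxG] := ex_maxnP ex0 bnd.
exists G => u; split=> [Pu|/GP//]; have [//|uG] := boolP (u <= G)%MS.
have /maxG : `[< good (\rank (G + u)%MS) >].
  apply/asboolP; exists (G + u)%MS; split=> // w /sub_addsmxP[[a b] /= ->].
  rewrite addrC (mx11_scalar b) mul_scalar_mx; apply: Plin => //.
  by apply: GP; apply: submxMl.
rewrite leqNgt rank_ltmx // ltmxE addsmxSl /=.
by apply: contra uG; apply: submx_trans; apply: addsmxSr.
Qed.

Lemma mulmx_col p m q (A : 'M[R]_(p, m)) (C : 'M[R]_(m, q)) i :
  A *m col i C = col i (A *m C).
Proof. by rewrite !colE mulmxA. Qed.

Lemma mxtrace_mxvec m (C : 'cV[R]_(m * m)) (A : 'M[R]_m) :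
  \tr ((\matrix_(i, j) C (mxvec_index j i) 0) *m A) = (mxvec A *m C) 0 0.
Proof.
rewrite [RHS]mxE (reindex _ (curry_mxvec_bij m m)) /= /mxtrace.
under [LHS]eq_bigr => i _ do rewrite mxE.
rewrite exchange_big pair_bigA; apply: eq_bigr => -[i j] _ /=.
by rewrite mxE mxvecE mulrC.
Qed.

(** A column of the cokernel of the vectorised subspace is the separating functional; the trace
    pairing turns it into a matrix. *)
Lemma mx_separation m (L : 'M[R]_m -> Prop) M :
  L 0 -> (forall c A B, L A -> L B -> L (c *: A + B)) -> ~ L M ->
  exists Y : 'M[R]_m, (forall A, L A -> \tr (Y *m A) = 0) /\ \tr (Y *m M) != 0.
Proof.
move=> L0 Llin LM; pose P (u : 'rV[R]_(m * m)) := L (vec_mx u).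
have [|c u v|G GP] := @subspace_mx _ P; first by rewrite /P linear0.
  by rewrite /P linearP; apply: Llin.
have : mxvec M *m cokermx G != 0.
  by rewrite -submxE; apply/negP => /GP; rewrite /P mxvecK.
move=> /eqP/rowP/existsNP[k /eqP Mk].
pose C := col k (cokermx G); exists (\matrix_(i, j) C (mxvec_index j i) 0); split=> [A LA|].
  rewrite mxtrace_mxvec /C mulmx_col.
  suff -> : mxvec A *m cokermx G = 0 by rewrite !mxE.
  by apply/eqP; rewrite -submxE; apply/GP; rewrite /P mxvecK.
rewrite mxtrace_mxvec /C mulmx_col [X in X != _]mxE.
by move: Mk; rewrite [X in _ != X]mxE.
Qed.

Lemma tr_quad m (Q : 'M[R]_m) y : \tr (Q *m (y^T *m y)) = qf Q y.
Proof. by rewrite mulmxA mxtrace_mulC mulmxA /qf /bf /mxtrace big_ord1. Qed.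

Lemma tr_eq0 m (M : 'M[R]_m) : (forall A, \tr (M *m A) = 0) -> M = 0.
Proof.
move=> h; apply/matrixP => i j; rewrite mxE; have := h (delta_mx j i).
rewrite /mxtrace (bigD1 i) //= big1 => [|k /negPf ki].
  rewrite addr0 mxE (bigD1 j) //= big1 => [|l /negPf lj].
    by rewrite mxE !eqxx mulr1 addr0.
  by rewrite mxE lj mulr0.
by rewrite mxE big1 // => l _; rewrite mxE ki andbF mulr0.
Qed.

(** * Quadrics with a prescribed differential *)

Section TangentQuadrics.
Variables (m : nat) (L : 'M[R]_m -> Prop) (M0 : 'M[R]_m).
Hypothesis L_sym : forall A, L A -> A^T = A.
Hypothesis L_lin : forall c A B, L A -> L B -> L (c *: A + B).
Hypothesis L_tr_ge0 : forall Q M, (forall y, L (y^T *m y) -> 0 <= qf Q y) ->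
  L M -> psdmx M -> 0 <= \tr (Q *m M).
Hypothesis L_M0 : L M0.
Hypothesis M0_interior : forall A, A^T = A -> exists c : R, 0 <= c /\ psdmx (c *: M0 - A).

Lemma L0 : L 0.
Proof. by rewrite -(subrr M0) addrC -scaleN1r; apply: L_lin. Qed.

Lemma L_add A B : L A -> L B -> L (A + B).
Proof. by move=> LA LB; rewrite -[A]scale1r; apply: L_lin. Qed.

Lemma L_scale c A : L A -> L (c *: A).
Proof. by move=> LA; rewrite -[_ *: _]addr0; apply: L_lin => //; apply: L0. Qed.

(* Were [a b^T] not of this form modulo the annihilator of [L], some [M] in [L]
   would separate it, and the psd matrices [B^T B + t M + t^2 c M0] of [L]
   would be negative on [C |x Pr|^2 - (x a) (x b)] for small [t]. *)
Lemma tangent_quadric k (B : 'M[R]_(k, m)) (X : 'M[R]_(m, k)) (a b : 'cV[R]_m) C :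
  B *m X = 1%:M -> (forall i, L ((row i B)^T *m row i B)) -> B *m b = 0 ->
  (forall y, L (y^T *m y) ->
     (y *m a) 0 0 * (y *m b) 0 0 <= C * qf 1%:M (y *m (1%:M - X *m B))) ->
  exists A, forall M, L M ->
    \tr ((a *m b^T + (1%:M - X *m B) *m A *m (1%:M - X *m B)^T) *m M) = 0.
Proof.
move=> BX LB Bb hC; set Pr := 1%:M - X *m B.
have BPr : B *m Pr = 0 by rewrite mulmxBr mulmx1 mulmxA BX mul1mx subrr.
pose U Z := exists A Y, Z = Pr *m A *m Pr^T + Y /\ forall M, L M -> \tr (Y *m M) = 0.
have [[A [Y [E hY]]]|nU] := pselect (U (a *m b^T)).
  exists (- A) => M LM; rewrite E addrAC mulmxN mulNmx subrr add0r.
  exact: hY.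
have [||M [MU Mab]] := mx_separation _ _ nU.
- exists 0, 0; rewrite mulmx0 mul0mx addr0; split=> // M _.
  by rewrite mul0mx mxtrace0.
- move=> c _ _ [A [Y [-> hY]]] [A' [Y' [-> hY']]]; exists (c *: A + A'), (c *: Y + Y').
  split=> [|M LM]; last first.
    by rewrite mulmxDl -scalemxAl mxtraceD mxtraceZ hY // hY' // mulr0 addr0.
  by rewrite mulmxDr mulmxDl -scalemxAr -scalemxAl scalerDr addrACA.
(* [M] kills the annihilator of [L], so it lies in [L]. *)
have LM : L M.
  have [//|nLM] := pselect (L M).
  have [Y [hY YM]] := mx_separation L0 L_lin nLM; case/eqP: YM.
  rewrite mxtrace_mulC; apply: MU; exists 0, Y.
  by rewrite mulmx0 mul0mx add0r.
have PMP : Pr^T *m M *m Pr = 0.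
  apply: tr_eq0 => A; rewrite -!mulmxA mxtrace_mulC.
  rewrite -!mulmxA (mulmxA Pr); apply: MU; exists A, 0.
  by rewrite addr0; split=> // ? _; rewrite mul0mx mxtrace0.
(* Since [Pr^T M Pr = 0], this choice makes [qf M v] the inner product of [v B^T] and [v Psi]. Hence
   [B^T B + t M + t^2 Psi Psi^T] is psd for every [t], and [c M0] dominates [Psi Psi^T]. *)
pose Psi := (X^T *m M *m (1%:M + Pr))^T.
have [c [c0 hc]] : exists c : R, 0 <= c /\ psdmx (c *: M0 - Psi *m Psi^T).
  by apply: M0_interior; rewrite trmx_mul trmxK.
have sM := L_sym LM.
have PrT : Pr^T = 1%:M - B^T *m X^T by rewrite linearB /= trmx1 trmx_mul.
have qM v : qf M v = ((v *m B^T) *m (v *m Psi)^T) 0 0.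
  have vE : v = v *m Pr^T + v *m B^T *m X^T.
    by rewrite PrT mulmxBr mulmx1 mulmxA subrK.
  rewrite /Psi trmx_mul trmxK mulmxDr mulmx1 !mulmxDl (mulmxDr (v *m B^T)).
  set w := v *m B^T *m X^T in vE *.
  have -> : v *m B^T *m (X^T *m M *m Pr *m v^T) = w *m M *m (v *m Pr^T)^T.
    by rewrite /w trmx_mul trmxK !mulmxA.
  have -> : v *m B^T *m (X^T *m M *m v^T) = w *m M *m v^T by rewrite /w !mulmxA.
  have h0 : bf M (v *m Pr^T) (v *m Pr^T) = 0.
    have -> : bf M (v *m Pr^T) (v *m Pr^T) = bf (Pr^T *m M *m Pr) v v.
      by rewrite /bf trmx_mul trmxK !mulmxA.
    by rewrite PMP /bf mulmx0 mul0mx mxE.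
  rewrite [RHS]mxE.
  rewrite -/(bf M w v) -/(bf M w (v *m Pr^T)) /qf; set u := v *m Pr^T in vE h0 *.
  rewrite vE !bfDl !bfDr h0 (bf_sym u w sM); ring.
pose E := B^T *m B.
have LE : L E.
  have -> : E = \sum_i (row i B)^T *m row i B.
    apply/matrixP => i j; rewrite summxE [LHS]mxE; apply: eq_bigr => l _.
    by rewrite [RHS]mxE big_ord1 !mxE.
  by apply: big_ind => [||i _]; [apply: L0|apply: L_add|apply: LB].
have sE : E^T = E by rewrite trmx_mul trmxK.
have trR Q : \tr (Pr *m Pr^T *m Q) = \tr (Pr^T *m Q *m Pr).
  by rewrite -mulmxA mxtrace_mulC.
have trab Q : \tr (a *m b^T *m Q) = \tr (b^T *m Q *m a).
  have -> : a *m b^T *m Q = a *m (b^T *m Q) by rewrite mulmxA.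
  exact: mxtrace_mulC.
set beta := \tr (M *m (a *m b^T)) in Mab.
pose K := C * (c * \tr (Pr *m Pr^T *m M0)) - c * \tr (a *m b^T *m M0).
(* Pair [C Pr Pr^T - a b^T] with the psd matrix [Pt] of [L]: the constant term vanishes by
   [B Pr = 0] and [B b = 0], and the linear one is [- t beta]. *)
have key t : t * beta <= t ^+ 2 * K.
  pose Pt := E + t *: M + (t ^+ 2 * c) *: M0.
  have LPt : L Pt by apply: L_add; [apply: L_add => //|]; apply: L_scale.
  have pPt : psdmx Pt.
    split; first exact: L_sym.
    move=> v; rewrite !qfD !qfZ qM -mulrA.
    have := hc.2 v; rewrite qfB qfZ qf_mulr subr_ge0 => h.
    have : t ^+ 2 * qf 1%:M (v *m Psi) <= t ^+ 2 * (c * qf M0 v).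
      by apply: ler_wpM2l h; apply: sqr_ge0.
    have : qf E v = qf 1%:M (v *m B^T) by rewrite -qf_mulr trmxK.
    move=> -> h1; apply: le_trans (_ : qf 1%:M (v *m B^T) +
      t * (v *m B^T *m (v *m Psi)^T) 0 0 + t ^+ 2 * qf 1%:M (v *m Psi) <= _); last first.
      by rewrite lerD2l.
    rewrite !sqnormE !mxE !mulr_sumr -!big_split; apply: sumr_ge0 => i _ /=.
    rewrite [(_^T) _ _]mxE; set p := _ 0 i; set q := (v *m Psi) 0 i.
    have -> : p ^+ 2 + t * (p * q) + t ^+ 2 * q ^+ 2 =
      (p + t * q / 2) ^+ 2 + (t * q) ^+ 2 * (3 / 4) by field.
    by apply: addr_ge0; [apply: sqr_ge0|apply: mulr_ge0; rewrite ?sqr_ge0 //; lra].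
  have := @L_tr_ge0 (C *: (Pr *m Pr^T) - a *m b^T) Pt _ LPt pPt.
  have -> : \tr ((C *: (Pr *m Pr^T) - a *m b^T) *m Pt) = t ^+ 2 * K - t * beta.
    have e1 : \tr (Pr *m Pr^T *m E) = 0.
      by rewrite trR /E mulmxA -mulmxA BPr mulmx0 mxtrace0.
    have e2 : \tr (a *m b^T *m E) = 0.
      by rewrite trab /E mulmxA -trmx_mul Bb trmx0 !mul0mx mxtrace0.
    have e3 : \tr (Pr *m Pr^T *m M) = 0 by rewrite trR PMP mxtrace0.
    have e4 : \tr (a *m b^T *m M) = beta by rewrite /beta mxtrace_mulC.
    have e5 Q : \tr (Q *m Pt) = \tr (Q *m E) + t * \tr (Q *m M) + t ^+ 2 * c * \tr (Q *m M0).
      by rewrite /Pt !mulmxDr -!scalemxAr !mxtraceD !mxtraceZ.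
    rewrite mulmxBl linearB /= -scalemxAl mxtraceZ !e5 e1 e2 e3 e4 /K; ring.
  rewrite subr_ge0; apply => y Ly; rewrite qfB qfZ qf_mulr subr_ge0.
  have -> : qf (a *m b^T) y = (y *m a) 0 0 * (y *m b) 0 0.
    rewrite /qf /bf mulmxA -mulmxA mxE big_ord1; congr (_ * _).
    by rewrite -trmx_mul mxE.
  exact: hC.
suff /eqP : beta = 0 by rewrite (negPf Mab).
have K1 : 0 < `|K| + 1 by rewrite ltr_wpDl.
(* Taking [t = beta / (|K| + 1)] in [key] forces [beta = 0]. *)
have h : beta ^+ 2 * (`|K| + 1) <= beta ^+ 2 * K.
  have K1' : `|K| + 1 != 0 by apply: lt0r_neq0.
  have := key (beta / (`|K| + 1)); rewrite -(ler_pM2r (exprn_gt0 2 K1)).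
  set l := (X in X <= _ -> _); set r := (X in _ <= X -> _).
  have -> : l = beta ^+ 2 * (`|K| + 1) by rewrite /l; field.
  by have -> : r = beta ^+ 2 * K by rewrite /r; field.
have hK := ler_norm K; have b0 := sqr_ge0 beta; apply/eqP.
rewrite -sqrf_eq0 eq_le b0 andbT; nra.
Qed.

End TangentQuadrics.
End Separation.

(** * Quadratic forms as polynomials and functionals on them *)

Section Quadrics.
Variables (R : realType) (n : nat).
Local Notation S := (Spoly R n).
Local Notation vec := ('I_n.+1 -> R).
Implicit Types (f p q : S) (v w y : vec) (A M : 'M[R]_n.+1) (l : S -> R).

Definition rv v : 'rV[R]_n.+1 := \row_i v i.

Definition gradmx f y : 'cV[R]_n.+1 := \col_i (f^`M(i)).@[y].

Lemma rvK (x : 'rV[R]_n.+1) : rv (x 0) = x.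
Proof. by apply/rowP => i; rewrite mxE. Qed.

Lemma dirder_gradmx f v y : (dirder v f).@[y] = (rv v *m gradmx f y) 0 0.
Proof. by rewrite meval_dirder mxE; apply: eq_bigr => i _; rewrite !mxE. Qed.

Lemma dirder_bounded f y : exists D, 0 <= D /\ forall v,
  (dirder v f).@[y] ^+ 2 <= D * qf 1%:M (rv v).
Proof.
have [D [D0 hD]] := qf_bounded (gradmx f y *m (gradmx f y)^T).
exists D; split=> // v; apply: le_trans (hD _).
by rewrite qf_mulr dirder_gradmx sqnormE big_ord1.
Qed.

(** The restriction to the unit ball keeps both factors of a product bounded, so that the estimate
    passes to products. *)
Lemma taylor f y : exists C, 0 <= C /\ forall v, qf 1%:M (rv v) <= 1 ->
  `|f.@[fun i => y i + v i] - f.@[y] - (dirder v f).@[y]| <= C * qf 1%:M (rv v).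
Proof.
elim/mpoly_alg_ind: f => [c|i|p q [C [C0 hC]] [C' [C'0 hC']]|p q [C [C0 hC]] [C' [C'0 hC']]].
- by exists 0; split=> // v _; rewrite !mevalC dirderC meval0 subrr subr0 normr0 mul0r.
- exists 0; split=> // v _; rewrite !mevalXU dirderX mevalC (_ : _ - _ - _ = 0) ?normr0 ?mul0r //.
  by ring.
- exists (C + C'); split=> [|v hv]; first exact: addr_ge0.
  rewrite mulrDl dirderD !mevalD; apply: le_trans (lerD (hC v hv) (hC' v hv)).
  apply: le_trans (ler_normD _ _); rewrite le_eqVlt; apply/orP; left.
  by apply/eqP; congr (`|_|); ring.
have [D [D0 hD]] := dirder_bounded p y; have [D' [D'0 hD']] := dirder_bounded q y.
exists (C * (`|q.@[y]| + 1 + D' + C') + (`|p.@[y]| + 1 + D) * C' + D + D').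
split=> [|v hv].
  by rewrite !addr_ge0 ?mulr_ge0 ?addr_ge0.
move: (hC v hv) (hC' v hv) (hD v) (hD' v) (sqnorm_ge0 (rv v)) (hv).
rewrite dirderM !mevalD !mevalM.
set N := qf _ _; set p1 := p.@[_]; set q1 := q.@[fun i => _].
set p0 := p.@[y]; set q0 := q.@[y]; set dp := (dirder v p).@[y]; set dq := (dirder v q).@[y].
move=> h h' hd hd' N0 N1.
have bnd (x K : R) : 0 <= K -> x ^+ 2 <= K * N -> `|x| <= 1 + K.
  move=> K0 hx; have := normr_ge0 x; rewrite -[x ^+ 2](real_normK (num_real x)) in hx.
  by nra.
have hdp := bnd _ _ D0 hd; have hdq := bnd _ _ D'0 hd'.
have -> : p1 * q1 - p0 * q0 - (dp * q0 + p0 * dq) =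
  (p1 - p0 - dp) * q1 + ((p0 + dp) * (q1 - q0 - dq) + dp * dq) by ring.
have hq1 : `|q1| <= `|q0| + 1 + D' + C'.
  have -> : q1 = q0 + dq + (q1 - q0 - dq) by ring.
  apply: le_trans (ler_normD _ _) _; apply: lerD.
    by apply: le_trans (ler_normD _ _) _; rewrite -addrA lerD2l.
  by apply: le_trans h' _; rewrite ler_piMr.
have hp1 : `|p0 + dp| <= `|p0| + 1 + D.
  by apply: le_trans (ler_normD _ _) _; rewrite -addrA lerD2l.
have A1 : `|(p1 - p0 - dp) * q1| <= C * N * (`|q0| + 1 + D' + C').
  by rewrite normrM; apply: ler_pM.
have A2 : `|(p0 + dp) * (q1 - q0 - dq)| <= (`|p0| + 1 + D) * (C' * N).
  by rewrite normrM; apply: ler_pM.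
have A3 : `|dp * dq| <= D * N + D' * N.
  rewrite ler_norml; have := sqr_ge0 (dp + dq); have := sqr_ge0 (dp - dq).
  by move=> *; apply/andP; split; nra.
apply: le_trans (ler_normD _ _) _; apply: le_trans (lerD A1 _) _.
  by apply: le_trans (ler_normD _ _) _; apply: lerD A2 A3.
by rewrite le_eqVlt; apply/orP; left; apply/eqP; ring.
Qed.

(** Small [v] are covered by [taylor]; for large [v] the linear term is itself at most a multiple of
    the squared norm. The constant must be uniform because the rescaled points to which this is
    applied need not be near [y]. *)
Lemma dirder_le f y : f.@[y] = 0 -> exists C, 0 <= C /\
  forall v, f.@[fun i => y i + v i] = 0 -> (dirder v f).@[y] <= C * qf 1%:M (rv v).
Proof.
move=> fy; have [C [C0 hC]] := taylor f y; have [D [D0 hD]] := dirder_bounded f y.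
exists (C + D + 1); split=> [|v fv]; first by rewrite !addr_ge0.
have [small|big] := leP (qf 1%:M (rv v)) 1.
  have := hC v small; rewrite fy fv subrr sub0r normrN => h.
  apply: le_trans (ler_norm _) _; apply: le_trans h _.
  by rewrite ler_wpM2r ?sqnorm_ge0 // -addrA lerDl addr_ge0.
have := hD v; move: big (sqnorm_ge0 (rv v)).
set d := (dirder v f).@[y]; set N := qf _ _ => N1 N0 dN.
have CN := mulr_ge0 C0 N0; have DN := mulr_ge0 D0 N0.
have d1 : 2 * d <= d ^+ 2 + 1 by have := sqr_ge0 (d - 1); lra.
by rewrite !mulrDl mul1r; lra.
Qed.

Definition quadform A : S := \sum_i \sum_j A i j *: ('X_i * 'X_j).

Lemma meval_quadform A v : (quadform A).@[v] = qf A (rv v).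
Proof.
rewrite /qf bfE raddf_sum; apply: eq_bigr => i _ /=.
rewrite raddf_sum; apply: eq_bigr => j _ /=.
by rewrite mevalZ mevalM !mevalXU !mxE mulrCA mulrA.
Qed.

Lemma quadform_homog A : quadform A \is 2.-homog.
Proof.
apply: rpred_sum => i _; apply: rpred_sum => j _; apply: rpredZ.
by apply: (@dhomogM _ _ _ 1 _ 1); rewrite dhomogX /= mdeg1.
Qed.

Lemma dirder_quadform A v y : (dirder v (quadform A)).@[y] = bf A (rv v) (rv y) + bf A (rv y) (rv v).
Proof.
rewrite dirder_sum raddf_sum !bfE -big_split; apply: eq_bigr => i _ /=.
rewrite dirder_sum raddf_sum -big_split; apply: eq_bigr => j _ /=.
rewrite dirderZ dirderM !dirderX mevalZ mevalD !mevalM !mevalC !mevalXU !mxE; ring.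
Qed.

Definition linpoly (x : 'cV[R]_n.+1) : S := \sum_i x i 0 *: 'X_i.

Lemma meval_linpoly x v : (linpoly x).@[v] = (rv v *m x) 0 0.
Proof.
rewrite raddf_sum mxE; apply: eq_bigr => i _ /=.
by rewrite mevalZ mevalXU mxE mulrC.
Qed.

Lemma linpoly_homog x : linpoly x \is 1.-homog.
Proof. by apply: rpred_sum => i _; apply: rpredZ; rewrite dhomogX /= mdeg1. Qed.

Lemma linpolyK f : f \is 1.-homog -> f = linpoly (gradmx f (fun=> 0)).
Proof.
move=> hf; apply: mpoly_ext => v; rewrite meval_linpoly (linform_eval _ hf) mxE.
by apply: eq_bigr => i _; rewrite !mxE.
Qed.

Lemma linpoly_sq x : linpoly x * linpoly x = quadform (x *m x^T).
Proof.
apply: mpoly_ext => v; rewrite mevalM meval_quadform qf_mulr sqnormE big_ord1.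
by rewrite meval_linpoly expr2.
Qed.

(** Half the Hessian at the origin, which is the Gram matrix of the degree-2 component. *)
Definition hess p : 'M[R]_n.+1 :=
  \matrix_(i, j) (2%:R^-1 * (p^`M(i)^`M(j)).@[fun=> 0]).

Lemma hessK p : p \is 2.-homog -> quadform (hess p) = p.
Proof.
move=> hp; apply: mpoly_ext => v; rewrite meval_quadform /qf bfE.
have two : (2%:R : R) != 0 by rewrite pnatr_eq0.
apply: (mulfI two); rewrite -(euler_eval v hp) meval_dirder mulr_sumr.
apply: eq_bigr => i _; rewrite (linform_eval _ (homog_mderiv i hp)) !mulr_sumr.
by apply: eq_bigr => j _; rewrite !mxE; field.
Qed.

Lemma hess_linear (a : R) p q : hess (a *: p + q) = a *: hess p + hess q.
Proof.
apply/matrixP => i j; rewrite !mxE !mderivD !mderivZ mevalD mevalZ; ring.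
Qed.

Lemma hess_pihomog p : hess (pihomog mdeg 2 p) = hess p.
Proof.
apply/matrixP => i j; rewrite !mxE; congr (_ * _).
by rewrite !meval_at0 !mcoeff_deriv mcoeff_pihomog add0m mdegD !mdeg1.
Qed.

Lemma hess_XX i j : hess ('X_i * 'X_j) = 2%:R^-1 *: (delta_mx i j + delta_mx j i).
Proof.
apply/matrixP => a b; rewrite !mxE; congr (_ * _).
rewrite mderivM !mderivXU mderivD !mderivM !mderivC !mderivXU mul0r mulr0 add0r addr0.
by rewrite mevalD !mevalM !mevalC -!mulnb !natrM (mulrC (b == i)%:R).
Qed.

(** The inverse of [Bmat] on symmetric matrices. *)
Definition lfun M : S -> R := fun p => \tr (hess p *m M).

Lemma S2dual_lfun M : S2dual (lfun M).
Proof.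
split=> [a p q|p]; last by rewrite /lfun hess_pihomog.
by rewrite /lfun hess_linear mulmxDl -scalemxAl mxtraceD mxtraceZ.
Qed.

Lemma lfun_lin (a : R) M M' : lfun (a *: M + M') = (fun p => a * lfun M p + lfun M' p).
Proof.
by apply: funext => p; rewrite /lfun mulmxDr -scalemxAr mxtraceD mxtraceZ.
Qed.

Section S2dualTheory.
Variable l : S -> R.
Hypothesis hl : S2dual l.

Lemma S2dual0 : l 0 = 0.
Proof. by have := hl.1 (-1) 0 0; rewrite scaler0 addr0 mulN1r addNr. Qed.

Lemma S2dualD p q : l (p + q) = l p + l q.
Proof. by have := hl.1 1 p q; rewrite scale1r mul1r. Qed.

Lemma S2dualZ a p : l (a *: p) = a * l p.
Proof. by have := hl.1 a p 0; rewrite !addr0 S2dual0 addr0. Qed.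

Lemma S2dual_quadform A : l (quadform A) = \tr (A *m (Bmat l)^T).
Proof.
rewrite (big_morph l S2dualD S2dual0); apply: eq_bigr => i _.
rewrite (big_morph l S2dualD S2dual0) mxE; apply: eq_bigr => j _.
by rewrite S2dualZ !mxE.
Qed.

Lemma Bmat_sym : (Bmat l)^T = Bmat l.
Proof. by apply/matrixP => i j; rewrite !mxE mulrC. Qed.

Lemma BmatK : lfun (Bmat l) = l.
Proof.
apply: funext => p; rewrite hl.2 -[in RHS](hessK (pihomogP _ _ _)) S2dual_quadform.
by rewrite hess_pihomog Bmat_sym.
Qed.

Lemma S2dual_sq x : l (linpoly x * linpoly x) = qf (Bmat l) x^T.
Proof.
rewrite linpoly_sq S2dual_quadform Bmat_sym mxtrace_mulC.
by rewrite -{1}(trmxK x) tr_quad.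
Qed.

Lemma psdP : psd l <-> psdmx (Bmat l).
Proof.
split=> [h|[_ h] f /linpolyK ->]; last by rewrite S2dual_sq.
split; first exact: Bmat_sym.
by move=> v; have := h _ (linpoly_homog v^T); rewrite S2dual_sq trmxK.
Qed.

End S2dualTheory.

Lemma lfunK M : M^T = M -> Bmat (lfun M) = M.
Proof.
move=> sM; apply/matrixP => i j; rewrite mxE /lfun hess_XX -scalemxAl mxtraceZ.
have d a b : \tr (delta_mx a b *m M) = M b a.
  rewrite /mxtrace (bigD1 a) //= big1 => [|k /negPf ka].
    rewrite addr0 mxE (bigD1 b) //= big1 => [|k /negPf kb].
      by rewrite mxE !eqxx mul1r addr0.
    by rewrite mxE kb andbF mul0r.
  by rewrite mxE big1 // => k' _; rewrite mxE ka mul0r.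
rewrite mulmxDl mxtraceD !d -{1}sM mxE; by field.
Qed.

Lemma psd_lfun M : M^T = M -> psd (lfun M) <-> psdmx M.
Proof. by move=> sM; rewrite (psdP (S2dual_lfun M)) lfunK. Qed.

End Quadrics.

(** * Cones over projections of the point set *)

Section Points.
Variables (R : realType) (n : nat).
Local Notation S := (Spoly R n).
Local Notation vec := ('I_n.+1 -> R).
Variables (L : 'M[R]_n.+1 -> Prop) (M0 : 'M[R]_n.+1).
Hypothesis L_sym : forall A, L A -> A^T = A.
Hypothesis L_lin : forall c A B, L A -> L B -> L (c *: A + B).
Hypothesis L_tr_ge0 : forall Q M, (forall y, L (y^T *m y) -> 0 <= qf Q y) ->
  L M -> psdmx M -> 0 <= \tr (Q *m M).
Hypothesis L_M0 : L M0.
Hypothesis M0_interior : forall A, A^T = A -> exists c : R, 0 <= c /\ psdmx (c *: M0 - A).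
Implicit Types (y w : 'rV[R]_n.+1) (x v z : vec) (f : S).

Definition pt y := y != 0 /\ L (y^T *m y).

Lemma pt_scale (t : R) y : t != 0 -> pt y -> pt (t *: y).
Proof.
move=> t0 [y0 Ly]; split; first by rewrite scaler_eq0 negb_or t0.
rewrite [(t *: y)^T]linearZ /= -scalemxAl -scalemxAr scalerA.
exact: (L_scale L_lin L_M0).
Qed.

(** Applying [L_tr_ge0] to [Q] and [-Q] gives zero on psd elements of [L]. Subtracting any element
    of [L] from a suitable multiple of [M0] gives a psd one, and the choice [-M0] settles [M0]
    itself. *)
Lemma tr_pt_eq0 Q M : (forall y, pt y -> qf Q y = 0) -> L M -> \tr (Q *m M) = 0.
Proof.
move=> Q0 LM; have Q0' y : L (y^T *m y) -> qf Q y = 0.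
  have [->|yn0] := eqVneq y 0; first by rewrite /qf /bf !mul0mx mxE.
  by move=> Ly; apply: Q0.
have psd0 M' : L M' -> psdmx M' -> \tr (Q *m M') = 0.
  move=> LM' pM'; apply/eqP; rewrite eq_le; apply/andP; split.
    rewrite -oppr_ge0 -linearN -mulNmx; apply: L_tr_ge0 => // y /Q0'.
    by rewrite qfN => ->; rewrite oppr0.
  by apply: L_tr_ge0 => // y /Q0' ->.
have tr0 A : L A -> exists c : R, 0 <= c /\ \tr (Q *m (c *: M0 - A)) = 0.
  move=> LA; have [c [c0 hc]] := M0_interior (L_sym LA); exists c; split=> //.
  apply: psd0 => //; rewrite addrC -scaleN1r; apply: L_lin => //.
  exact: (L_scale L_lin L_M0).
have trE c A : \tr (Q *m (c *: M0 - A)) = c * \tr (Q *m M0) - \tr (Q *m A).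
  by rewrite mulmxBr -scalemxAr linearB /= mxtraceZ.
have [c [c0]] := tr0 _ (L_scale L_lin L_M0 (-1) L_M0); rewrite trE -scalemxAr mxtraceZ.
rewrite -mulrBl opprK => /eqP; rewrite mulf_eq0 gt_eqF ?ltr_wpDl //= => /eqP T0.
have [c' [_]] := tr0 _ LM; rewrite trE T0 mulr0 sub0r => /eqP.
by rewrite oppr_eq0 => /eqP.
Qed.

Lemma M0_posdef y : qf M0 y = 0 -> y = 0.
Proof.
move=> y0; apply: sqnorm_eq0; have [c [_ [_ hc]]] := M0_interior (trmx1 R n.+1).
have := hc y; rewrite qfB qfZ y0 mulr0 sub0r oppr_ge0 => h.
by apply/eqP; rewrite eq_le h sqnorm_ge0.
Qed.

(** The square of the linear form [h] is a quadric vanishing at all points, so it pairs to zero with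
    [M0], which is positive definite. *)
Lemma pt_nondeg (h : 'cV[R]_n.+1) : (forall y, pt y -> (y *m h) 0 0 = 0) -> h = 0.
Proof.
move=> h0; apply: trmx_inj; rewrite trmx0; apply: M0_posdef.
have := @tr_pt_eq0 (h *m h^T) M0; rewrite mxtrace_mulC.
have {2}-> : h *m h^T = h^T^T *m h^T by rewrite trmxK.
rewrite tr_quad; apply=> // y py.
by rewrite qf_mulr sqnormE big_ord1 h0 // expr0n.
Qed.

(** The set [Z + span] with the rows of [B] spanning; [Z] itself is the case of no rows. *)
Definition cone_over k (B : 'M[R]_(k, n.+1)) : vec -> Prop :=
  fun x => exists c : 'rV_k, pt (rv x - c *m B).

Lemma rv_shift x (t : R) v : rv (shift x t v) = rv x + t *: rv v.
Proof. by apply/rowP => i; rewrite !mxE. Qed.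

Lemma rv_scale (t : R) x : rv (fun i => t * x i) = t *: rv x.
Proof. by apply/rowP => i; rewrite !mxE. Qed.

Lemma cone_cone_over k (B : 'M[R]_(k, n.+1)) : cone (cone_over B).
Proof.
move=> x t t0 [c pc]; exists (t *: c).
by rewrite rv_scale -scalemxAl -scalerBr; apply: pt_scale.
Qed.

Lemma pt_cone_over k (B : 'M[R]_(k, n.+1)) y : pt y -> cone_over B (y 0).
Proof. by move=> py; exists 0; rewrite mul0mx subr0 rvK. Qed.

(** * Differentials of the ideal of a cone over a projection *)

Section Tangent.
Variables (k : nat) (B : 'M[R]_(k, n.+1)).
Hypothesis B_free : row_free B.
Hypothesis B_pt : forall i, pt (row i B).
Let W := cone_over B.

Lemma cone_over_shift x t (c : 'rV_k) : W x -> W (shift x t ((c *m B) 0)).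
Proof.
move=> [c' pc]; exists (c' + t *: c).
by rewrite rv_shift rvK mulmxDl -scalemxAl opprD addrACA subrr addr0.
Qed.

(** From [y] in the span, any nonzero step along a point [w] lands in the cone, so the differential
    at [y] kills all points, and these span. *)
Lemma dirder_span0 (y : vec) f : (rv y <= B)%MS -> vanish W f ->
  forall v, (dirder v f).@[y] = 0.
Proof.
move=> /submxP[c yE] vf.
suff h0 : gradmx f y = 0 by move=> v; rewrite dirder_gradmx h0 mulmx0 mxE.
apply: pt_nondeg => w pw; rewrite -[w]rvK -dirder_gradmx.
have [] // := @dirder_eval0 _ _ f y (w 0) _.
move=> t t0; apply: (vf (shift y t (w 0))); exists c.
by rewrite rv_shift rvK yE addrAC subrr add0r; apply: pt_scale.
Qed.

Lemma row_free_snoc (z : 'rV[R]_n.+1) : row_free B -> ~~ (z <= B)%MS -> row_free (col_mx z B).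
Proof.
move=> fB zB; rewrite /row_free eqn_leq rank_leq_row /= -addsmxE.
have /rank_ltmx : (B < z + B)%MS.
  by rewrite ltmxE addsmxSr; apply: contra zB; apply: submx_trans; apply: addsmxSl.
by rewrite (eqP fB).
Qed.

Lemma row_col_mx (z : 'rV[R]_n.+1) (i : 'I_(1 + k)) :
  row i (col_mx z B) = z \/ exists j, row i (col_mx z B) = row j B.
Proof.
rewrite -(splitK i); case: (split i) => j /=.
  by left; rewrite rowKu ord1 row_id.
by right; exists j; rewrite rowKd.
Qed.

(** Outside the span of [B], write [y = z + c0 B] with [z] a point. [tangent_quadric] yields a form
    [a b^T + Pr A Pr^T] orthogonal to [L], where [b] is the gradient of [f] at [y]. As [y a = 1],
    [y b = 0] and [y Pr = 0], its differential at [y] is [b]. *)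
Lemma tangent_by_quadrics (y : vec) f : W y -> vanish W f -> exists F, Ipart W 2 F /\
  forall v, (dirder v F).@[y] = (dirder v f).@[y].
Proof.
move=> Wy vf; have [yB|yB] := boolP (rv y <= B)%MS.
  exists 0; split; first exact: Ipart0.
  by move=> v; rewrite dirder0 meval0 dirder_span0.
have [c0] := Wy; have [z zE] : exists z : 'rV[R]_n.+1, z = rv y - c0 *m B by eexists.
rewrite -zE => pz; have yE : rv y = z + c0 *m B by rewrite zE subrK.
have zB : ~~ (z <= B)%MS.
  apply: contra yB => zB; rewrite yE.
  by rewrite addmx_sub // submxMl.
have /row_freeP[X B1X] := row_free_snoc B_free zB.
(* Dual coordinates: the linear form [a] is 1 at [z] and 0 on the span of [B]. *)
pose a := lsubmx X; pose X2 := rsubmx X.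
have XE : X = row_mx a X2 by rewrite hsubmxK.
have [za zX2 Ba BX2] : [/\ z *m a = 1%:M, z *m X2 = 0, B *m a = 0 & B *m X2 = 1%:M].
  by move: B1X; rewrite XE mul_col_row scalar_mx_block => /eq_block_mx[].
pose b := gradmx f y.
have Bb : B *m b = 0.
  apply/row_matrixP => i; rewrite row0 row_mul; apply/rowP => j; rewrite ord1 [RHS]mxE.
  rewrite -[row i B]rvK -dirder_gradmx.
  have [] // := @dirder_eval0 _ _ f y (row i B 0) _.
  move=> t _; apply: (vf (shift y t (row i B 0))).
  by rewrite rowE; apply: cone_over_shift.
have yb : rv y *m b = 0.
  apply/rowP => j; rewrite ord1 [RHS]mxE -dirder_gradmx.
  have l0 : line f (fun=> 0) y = 0.
    apply: poly_eq0_off0 => t t0; rewrite line0E; apply: vf.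
    exact: cone_cone_over.
  have := deriv_line f (fun=> 0) y; rewrite l0 deriv0 => /(congr1 (horner^~ 1)).
  rewrite horner0 horner_line => ->.
  by apply: meval_eq => i; rewrite add0r mul1r.
have zb : z *m b = 0 by rewrite zE mulmxBl yb -mulmxA Bb mulmx0 subr0.
pose B1 := col_mx z B; pose Pr := 1%:M - X *m B1.
have B1b : B1 *m b = 0 by rewrite mul_col_mx zb Bb col_mx0.
have PrE : Pr = 1%:M - a *m z - X2 *m B.
  by rewrite /Pr XE mul_row_col opprD addrA.
have B1Pr : B1 *m Pr = 0 by rewrite mulmxBr mulmx1 mulmxA B1X mul1mx subrr.
have [zPr BPr] : z *m Pr = 0 /\ B *m Pr = 0.
  move: B1Pr; rewrite mul_col_mx -[0]vsubmxK => /eq_col_mx[-> ->].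
  by rewrite !linear0.
have ya : rv y *m a = 1%:M.
  by rewrite yE mulmxDl za -mulmxA Ba mulmx0 addr0.
have yPr : rv y *m Pr = 0.
  by rewrite yE mulmxDl zPr -mulmxA BPr mulmx0 addr0.
have [C [C0 hC]] := dirder_le (vf y Wy).
(* For [s = w a] nonzero, rescaling [w] by [s^-1] and moving it along the span of [B] lands in [W]
   at [y + x] with [x = s^-1 w Pr], where [dirder_le] applies. *)
have bound w : L (w^T *m w) -> (w *m a) 0 0 * (w *m b) 0 0 <= C * qf 1%:M (w *m Pr).
  have N0 := sqnorm_ge0 (w *m Pr).
  have [->|w0] := eqVneq w 0; first by rewrite !mul0mx mxE mul0r mulr_ge0 // sqnorm_ge0.
  move=> Lw; have pw : pt w by split.
  set s := (w *m a) 0 0; have [->|s0] := eqVneq s 0; first by rewrite mul0r mulr_ge0.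
  pose x := s^-1 *: (w *m Pr).
  have waE : w *m a = s%:M by rewrite [LHS]mx11_scalar.
  have Wyx : W (fun i => y i + x 0 i).
    exists (c0 - s^-1 *: (w *m X2)).
    have -> : rv (fun i => y i + x 0 i) = rv y + x by apply/rowP => i; rewrite !mxE.
    have -> : rv y + x - (c0 - s^-1 *: (w *m X2)) *m B = s^-1 *: w.
      rewrite /x PrE !mulmxBr mulmx1 mulmxBl -scalemxAl !mulmxA waE mul_scalar_mx.
      rewrite !scalerBr scalerA mulVf // scale1r opprB yE.
      move: (c0 *m B) (s^-1 *: (w *m X2 *m B)) (s^-1 *: w) => r1 r2 r3.
      by apply/rowP => i; rewrite !mxE; ring.
    by apply: pt_scale; rewrite ?invr_eq0.
  have := hC (x 0) (vf _ Wyx); rewrite dirder_gradmx rvK -/b.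
  have -> : (x *m b) 0 0 = s^-1 * (w *m b) 0 0.
    rewrite /x -scalemxAl mxE; congr (_ * _); rewrite -mulmxA /Pr mulmxBl mul1mx -mulmxA B1b.
    by rewrite mulmx0 subr0.
  have -> : qf 1%:M x = s^-1 ^+ 2 * qf 1%:M (w *m Pr).
    by rewrite /x /qf bfZl bfZr mulrA expr2.
  have s2 : 0 < s ^+ 2 by rewrite lt_neqAle eq_sym sqrf_eq0 s0 sqr_ge0.
  rewrite -(ler_pM2l s2).
  have -> : s ^+ 2 * (s^-1 * (w *m b) 0 0) = s * (w *m b) 0 0 by field.
  by have -> : s ^+ 2 * (C * (s^-1 ^+ 2 * qf 1%:M (w *m Pr))) = C * qf 1%:M (w *m Pr) by field.
have B1L i : L ((row i B1)^T *m row i B1).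
  by have [->|[j ->]] := row_col_mx z i; [case: pz | case: (B_pt j)].
have [A hA] := tangent_quadric L_sym L_lin L_tr_ge0 L_M0 M0_interior B1X B1L B1b bound.
pose G := a *m b^T + Pr *m A *m Pr^T.
have bfG (u w : 'rV_n.+1) :
    bf G u w = (u *m a) 0 0 * (w *m b) 0 0 + bf A (u *m Pr) (w *m Pr).
  rewrite bfDA; congr (_ + _); last by rewrite /bf trmx_mul !mulmxA.
  rewrite /bf mulmxA -mulmxA mxE big_ord1; congr (_ * _).
  by rewrite -trmx_mul mxE.
exists (quadform G); split; first split; first exact: quadform_homog.
  move=> x [c px]; rewrite meval_quadform -(subrK (c *m B) (rv x)).
  set p := rv x - c *m B in px *.
  (* The rows of [B] lie in the radical of [G]. *)
  have -> : qf G (p + c *m B) = qf G p.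
    by rewrite /qf !bfG !mulmxDl -!(mulmxA c) Ba Bb BPr !mulmx0 !addr0.
  by rewrite -tr_quad hA //; case: px.
have bf0r u : bf A u 0 = 0 by rewrite /bf trmx0 mulmx0 mxE.
have bf0l u : bf A 0 u = 0 by rewrite /bf !mul0mx mxE.
move=> v; rewrite dirder_quadform !bfG ya yb yPr bf0r bf0l dirder_gradmx.
have -> : (0 : 'M[R]_1) 0 0 = 0 by rewrite mxE.
have -> : (1%:M : 'M[R]_1) 0 0 = 1 by rewrite mxE eqxx.
by rewrite mulr0 mul1r !addr0 add0r.
Qed.

End Tangent.

Theorem reg_cone_over d k (B : 'M[R]_(k, n.+1)) : row_free B -> (forall i, pt (row i B)) ->
  (k + d)%N = n.+1 -> reg_le (cone_over B) 2.
Proof.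
elim: d k B => [|d IH] k B fB pB.
  rewrite addn0 => kn; apply: reg_full => x.
  have i0 : 'I_k by rewrite kn; exact: ord0.
  have /submxP[c cE] : (rv x - row i0 B <= B)%MS.
    by apply: submx_full; rewrite /row_full (eqP fB) kn.
  by exists c; rewrite -cE opprB addrCA subrr addr0.
rewrite addnS -addSn => kd.
have kn : (k < n.+1)%N by rewrite -kd leq_addr.
have [z0 [pz0 z0B]] : exists z0 : 'rV[R]_n.+1, pt z0 /\ ~~ (z0 <= B)%MS.
  have [//|h] := pselect (exists z0 : 'rV[R]_n.+1, pt z0 /\ ~~ (z0 <= B)%MS).
  have : cokermx B = 0.
    apply/trmx_inj/row_matrixP => i; rewrite trmx0 row0 -tr_col -trmx0; congr _^T.
    apply: pt_nondeg => y py; have yB : (y <= B)%MS.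
      by apply: contra_notT h => yB; exists y.
    by move: yB; rewrite submxE mulmx_col => /eqP ->; rewrite !mxE.
  move/(congr1 (@mxrank _ _ _)); rewrite mxrank_coker (eqP fB) mxrank0 => /eqP.
  by rewrite subn_eq0 leqNgt kn.
set W := cone_over B.
pose good r := exists z, W z /\ rank_ge W z r.
have g0 : good 0%N.
  exists (z0 0); split; first exact: pt_cone_over.
  by exists (fun=> 0), (fun=> z0 0); split=> [[]//|]; rewrite /jac det_mx00 oner_eq0.
have ex0 : exists r, `[< good r >] by exists 0%N; apply/asboolP.
have bnd r : `[< good r >] -> (r <= n.+1)%N.
  by move=> /asboolP[z [_]]; apply: rank_ge_bound.
have [r /asboolP gr rmax] := ex_maxnP ex0 bnd.
have kmax (y : vec) : W y -> ~ rank_ge W y r.+1.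
  move=> Wy ry; have /rmax : `[< good r.+1 >] by apply/asboolP; exists y.
  by rewrite ltnn.
(* A point of positive rank avoids the span of [B], where differentials of the ideal vanish; if the
   maximal rank is 0, any point outside the span serves. *)
have [z [Wz [zB [Q [V [IQ jacQ]]]]]] : exists z, W z /\ ~~ (rv z <= B)%MS /\ rank_ge W z r.
  case: r gr {rmax kmax} => [|r] gr.
    exists (z0 0); rewrite rvK; split; first exact: pt_cone_over.
    split=> //; exists (fun=> 0), (fun=> z0 0).
    by split=> [[]//|]; rewrite /jac det_mx00 oner_eq0.
  have [z [Wz rz]] := gr; exists z; split=> //; split=> //.
  apply/negP => zB; have [Q [V [IQ /eqP]]] := rz; apply.
  rewrite /jac (_ : map_mx _ _ = 0) ?det0 //; apply/matrixP => i j; rewrite !mxE.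
  by apply: (dirder_span0 zB) => //; have [] := IQ i.
have [c pz] := Wz; set p := rv z - c *m B in pz.
have zE : rv z = p + c *m B by rewrite subrK.
have pNB : ~~ (p <= B)%MS.
  by apply: contra zB => pB'; rewrite zE addmx_sub // submxMl.
have znz : exists l, z l != 0.
  have [//|h] := pselect (exists l, z l != 0); case/negP: zB.
  rewrite (_ : rv z = 0) ?sub0mx //; apply/rowP => l; rewrite !mxE.
  by apply/eqP; apply: contra_notT h => zl; exists l.
apply: (reg_le2_cyl (@cone_cone_over _ B) _ Wz znz IQ jacQ kmax).
  exact: tangent_by_quadrics.
(* Modulo the span of [B], [z] equals the point [p], so the cylinder is again a cone over
   independent points. *)
have -> : cyl W z = cone_over (col_mx p B).
  apply: funext => x; apply: propext; split=> [[w [t [[c' pw] ->]]]|[c1 p1]].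
    exists (row_mx t%:M (c' + t *: c)).
    rewrite mul_row_col rv_shift mul_scalar_mx zE.
    rewrite (_ : _ - _ = rv w - c' *m B) // mulmxDl -scalemxAl.
    by apply/rowP => i; rewrite !mxE; ring.
  pose t := lsubmx c1 0 0; exists (shift x (- t) z), t.
  split; last by rewrite shiftD addNr shift0.
  exists (rsubmx c1 - t *: c); rewrite rv_shift zE.
  move: p1; rewrite -{1}(hsubmxK c1) mul_row_col [lsubmx c1]mx11_scalar -/t mul_scalar_mx.
  congr pt; rewrite mulmxBl -scalemxAl; apply/rowP => i; rewrite !mxE; ring.
apply: (IH (1 + k)%N) => //; first exact: row_free_snoc.
by move=> i; have [->|[j ->]] := row_col_mx B p i.
Qed.

End Points.

(** * From functionals to symmetric matrices, and the conclusion *)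

Theorem theorem3p8 (R : realType) (n : nat) (L : (Spoly R n -> R) -> Prop) :
  is_subspace L ->
  (exists l, L l /\ in_interior_Splus l) ->
  (exists l, Splus l /\ ~ L l) ->
  (forall l, spans_extreme_ray (fun l' => Splus l' /\ L l') l -> rank_of l = 1%N) ->
  exists Z : ('I_n.+1 -> R) -> Prop,
    (forall v, Z v -> exists i, v i != 0) /\
    X_nondegenerate Z /\ two_regular Z /\
    (forall l, (Splus l /\ L l) <-> Hankel Z l) /\
    (forall l, L l <-> I2perp Z l).
Proof.
move=> [subL [L0 linL]] [l0 [Ll0 [S2l0 [eps [eps0 int0]]]]] [l1 [[S2l1 psd1] nL1]] extL.
pose Lm M := M^T = M /\ L (lfun M).
have Lm_sym A : Lm A -> A^T = A by case.
have LmE l : S2dual l -> L l <-> Lm (Bmat l).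
  by move=> hl; rewrite /Lm BmatK // Bmat_sym; split=> [|[]].
have Lm_lin c A B : Lm A -> Lm B -> Lm (c *: A + B).
  move=> [sA LA] [sB LB]; split; first by rewrite linearP /= sA sB.
  by rewrite lfun_lin; apply: linL.
have Lm0 : Lm 0.
  split; first exact: trmx0.
  by rewrite (_ : lfun 0 = fun=> 0) //; apply: funext => p; rewrite /lfun mulmx0 mxtrace0.
have Lm_ext M : Lm M -> psdmx M -> M != 0 ->
  (forall A B, Lm A -> Lm B -> psdmx A -> psdmx B -> M = A + B ->
    (exists c : R, 0 <= c /\ A = c *: M) /\ (exists c : R, 0 <= c /\ B = c *: M)) ->
  \rank M = 1%N.
  move=> [sM LM] pM Mn0 hM; rewrite -(lfunK sM); apply: extL; split.
    by split=> //; split; [apply: S2dual_lfun | apply/psd_lfun].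
  split.
    have [//|h] := pselect (exists p, lfun M p != 0); case/eqP: Mn0.
    rewrite -(lfunK sM); apply/matrixP => i j; rewrite !mxE.
    by apply/eqP; apply: contra_notT h => ne0; exists ('X_i * 'X_j).
  move=> a b [[Sa pa] La] [[Sb pb] Lb] E.
  have [||||| [c [c0 cE]] [c' [c'0 cE']]] := hM (Bmat a) (Bmat b).
  - exact/LmE.
  - exact/LmE.
  - exact/(psdP Sa).
  - exact/(psdP Sb).
  - by rewrite -(lfunK sM); apply/matrixP => i j; rewrite !mxE E.
  have lZ (t : R) p : lfun (t *: M) p = t * lfun M p.
    by rewrite /lfun -scalemxAr mxtraceZ.
  by split; [exists c | exists c']; split=> // p; rewrite -lZ -?cE -?cE' BmatK.
have Lm_tr := tr_ge0 Lm_lin Lm_ext.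
pose M0 := Bmat l0.
have LM0 : Lm M0 by apply/LmE.
(* An interior point absorbs every symmetric direction: [N + 1] strictly bounds the entries of [A],
   so moving from [M0] by [dl *: A] changes each coordinate by less than [eps]. *)
have M0_int A : A^T = A -> exists c : R, 0 <= c /\ psdmx (c *: M0 - A).
  move=> sA; pose N := \sum_i \sum_j `|A i j|; have N0 : 0 <= N.
    by do 2! (apply: sumr_ge0 => ? _).
  have N1 : 0 < N + 1 by rewrite ltr_wpDl.
  pose dl := eps / (N + 1); have dl0 : 0 < dl by rewrite divr_gt0.
  have sD : (M0 - dl *: A)^T = M0 - dl *: A by rewrite linearB linearZ /= sA Bmat_sym.
  have [_ pD] : Splus (lfun (M0 - dl *: A)).
    apply: int0 => [|i j]; first exact: S2dual_lfun.
    have := lfunK sD => /matrixP/(_ i j); rewrite mxE => ->.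
    rewrite !mxE addrAC subrr add0r normrN normrM gtr0_norm //.
    rewrite /dl mulrAC ltr_pdivrMr // ltr_pM2l //.
    apply: le_lt_trans (_ : N < _); last by rewrite ltrDl.
    rewrite /N (bigD1 i) //= (bigD1 j) //= -addrA lerDl addr_ge0 //.
      by apply: sumr_ge0.
    by do 2! (apply: sumr_ge0 => ? _).
  exists dl^-1; split; first by rewrite invr_ge0 ltW.
  have -> : dl^-1 *: M0 - A = dl^-1 *: (M0 - dl *: A).
    by rewrite scalerBr scalerA mulVf ?scale1r // gt_eqF.
  have [s p] := (psd_lfun sD).1 pD; split; first by rewrite linearZ /= s.
  by move=> v; rewrite qfZ mulr_ge0 // invr_ge0 ltW.
pose Z (v : 'I_n.+1 -> R) := pt Lm (rv v).
have nondeg := pt_nondeg Lm_sym Lm_lin Lm_tr LM0 M0_int.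
have I2L l : L l <-> I2perp Z l.
  split=> [Ll|[Sl h]].
    have Sl := subL _ Ll; split=> // f [hf vf].
    rewrite -(hessK hf) S2dual_quadform // Bmat_sym.
    apply: (tr_pt_eq0 Lm_sym Lm_lin Lm_tr LM0 M0_int); last exact/LmE.
    move=> y py; rewrite -[y]rvK -meval_quadform hessK //; apply: vf.
    by rewrite /Z rvK.
  (* A functional outside [L] is separated from [L] by a quadric orthogonal to [L]; such a quadric
     vanishes on [Z]. *)
  apply/LmE => //; have [//|nL] := pselect (Lm (Bmat l)).
  have [Y [hY /eqP Yl]] := mx_separation Lm0 Lm_lin nL; case: Yl.
  rewrite -(Bmat_sym l) -S2dual_quadform //; apply: h; split; first exact: quadform_homog.
  by move=> v [_ Lv]; rewrite meval_quadform -tr_quad hY.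
have X_nd : X_nondegenerate Z.
  move=> h /linpolyK hE vh; rewrite hE (_ : gradmx h _ = 0).
    by rewrite /linpoly big1 // => i _; rewrite mxE scale0r.
  apply: nondeg => y py; rewrite -[y]rvK -meval_linpoly -hE; apply: vh.
  by rewrite /Z rvK.
exists Z; split.
  move=> v [v0 _]; have [//|h] := pselect (exists i, v i != 0); case/eqP: v0.
  apply/rowP => i; rewrite !mxE.
  by apply/eqP; apply: contra_notT h => vi; exists i.
split=> //; split; last first.
  split=> [l|//]; rewrite /Hankel; split=> [[Sl Ll]|[Sl Il]]; split=> //; exact/I2L.
split.
  pose B := 0 : 'M[R]_(0, n.+1).
  have -> : Z = cone_over Lm B.
    apply: funext => x; apply: propext; split=> [zx|[c]].
      by exists 0; rewrite mul0mx subr0.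
    by rewrite [B]flatmx0 mulmx0 subr0.
  apply: (reg_cone_over Lm_sym Lm_lin Lm_tr LM0 M0_int (d := n.+1)) => //.
    by rewrite /row_free mxrank0.
  by case.
(* 1-regularity would generate the quadrics of the ideal by its linear forms, of which only 0
   exists; [l1] outside [L] detects a nonzero quadric. *)
move=> /(_ 0%N 2%N isT) tor.
have [f [If lf]] : exists f, Ipart Z 2 f /\ l1 f != 0.
  have [//|h] := pselect (exists f, Ipart Z 2 f /\ l1 f != 0); case: nL1.
  apply/I2L; split=> // f If; apply/eqP; apply: contra_notT h => lf.
  by exists f.
have [||b [chb fE]] := tor (fun A => if A == set0 then f else 0).
- move=> A; split=> [/cards0_eq -> | /eqP]; first by rewrite eqxx.
  by rewrite cards_eq0 => /negPf ->.
- by [].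
case/eqP: lf; have := fE set0 (cards0 _); rewrite eqxx => ->.
rewrite kdiffE big1 ?S2dual0 // => k _.
have [|hb vb] := (chb (k |: set0)).1; first by rewrite setU0 cards1.
by rewrite (X_nd _ hb vb) !mulr0.
Qed.
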